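(* Let $(M,\omega)$ be a symplectic manifold of dimension $2m$, let $\Lambda=(E,\lambda)$ and $\tilde\Lambda=(\tilde E,\tilde\lambda)$ be two transversal Lagrangian fields on $M$, and let $n\ge 2$. Let $V\rightrightarrows M$ be the local symplectic groupoid defined in the context, $V\subset T^*M$, and let $\mathcal{C}_n$ be the cyclic $n$-point Calabi function of the closed $(1,1)$-form $\Omega=\gamma^*\omega$ defined in the context. Then the Lagrangian manifold $V_n\subset V^n\subset (T^*M)^n$ of $n$-cycles of $V\rightrightarrows M$ has a generating function whose germ around the diagonal $M_n$ of $M^n$ is given by $\mathcal{C}_n$. That is, there are an open neighborhood $N$ of $M_n$ in $M^n$ contained in the domain of $\mathcal{C}_n$ and an open neighborhood $O$ in $(T^*M)^n$ of the diagonal $\{(z_x,\ldots,z_x)\mid x\in M\}$ of the zero section ($z_x$ being the zero covector at $x$) such that $$V_n\cap O=\left\{\left(\Big(x_1,\frac{\partial \mathcal{C}_n}{\partial x_1}\Big),\ldots,\Big(x_n,\frac{\partial \mathcal{C}_n}{\partial x_n}\Big)\right)\;\Big|\;(x_1,\ldots,x_n)\in N\right\}\cap O,$$ where $\partial\mathcal{C}_n/\partial x_k\in T^*_{x_k}M$ is the differential of $\mathcal{C}_n$ with respect to its $k$-th argument at $(x_1,\ldots,x_n)$.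
   Context: Lagrangian fields. A Lagrangian field $\Lambda=(E,\lambda)$ on $M$ is a (real, smooth) vector bundle $\pi:E\to M$ of rank $m$ equipped with a surjective submersion $\lambda:E\to M$ whose restriction to each fiber $E_x$ is an embedding onto a Lagrangian submanifold $\Lambda_x:=\lambda(E_x)$ of $M$ and such that $\lambda=\pi$ on the zero section $Z_E$. For $\tilde\Lambda=(\tilde E,\tilde\lambda)$ the bundle projection is $\tilde\pi$ and $\tilde\Lambda_x:=\tilde\lambda(\tilde E_x)$. The fields are transversal if $\Lambda_x$ intersects $\tilde\Lambda_x$ transversally at $x$ for all $x\in M$. The local symplectic groupoid. A form on the total space of a bundle is horizontal if it is annihilated by insertion of vertical vectors. There is a unique horizontal 1-form $\phi$ on $E$ vanishing on $Z_E$ with $\lambda^*\omega-\pi^*\omega=d\phi$, and a unique horizontal 1-form $\tilde\phi$ on $\tilde E$ vanishing on $Z_{\tilde E}$ with $\tilde\lambda^*\omega-\tilde\pi^*\omega=d\tilde\phi$. Let $\hat E:=E\oplus\tilde E=\{(z,\tilde z)\mid\pi(z)=\tilde\pi(\tilde z)\}$ with bundle projection $\hat\pi$ and zero section $Z_{\hat E}$, and $\tau(z,\tilde z)=z$, $\tilde\tau(z,\tilde z)=\tilde z$. The mapping $\chi:\hat E\to T^*M$ sends $(z,\tilde z)\in\hat E_x$ to the unique $\chi(z,\tilde z)\in T_x^*M$ with $(d\hat\pi_{(z,\tilde z)})^*\chi(z,\tilde z)=(\tilde\tau^*\tilde\phi-\tau^*\phi)(z,\tilde z)$. There are open neighborhoods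 $W_1,W_2$ of $Z_{\hat E}$ in $\hat E$ such that $\chi|_{W_1}$ is a diffeomorphism onto a neighborhood of the zero section of $T^*M$ and $(z,\tilde z)\mapsto(\tilde\lambda(\tilde z),\lambda(z))$ is a diffeomorphism of $W_2$ onto a neighborhood of the diagonal in $M^2$. Fix such $W_1,W_2$, put $W:=W_1\cap W_2$, $V:=\chi(W)$, and let $f:V\to M^2$ be the unique mapping with $f(\chi(z,\tilde z))=(\tilde\lambda(\tilde z),\lambda(z))$ on $W$; it is a diffeomorphism onto its image. The manifold $V$ with the symplectic form $-d\theta$ ($\theta=\xi_i dx^i$ the canonical 1-form on $T^*M$) is a local symplectic groupoid over $M$ with source $s=\pi_2\circ f$ and target $t=\pi_1\circ f$, where $\pi_1,\pi_2$ are the projections of $M^2$ to its factors, and with operations transported by $f$ from the pair groupoid $M^2$ (in which $(x,y)(y,z)=(x,z)$). Its set of $n$-cycles is $$V_n=\{(\alpha_1,\ldots,\alpha_n)\in V^n\mid s(\alpha_k)=t(\alpha_{k+1})\ (1\le k\le n-1),\ s(\alpha_n)=t(\alpha_1)\},$$ a Lagrangian submanifold of $V^n$ (product symplectic structure). The form $\Omega$. Let $\Gamma:=\{(z,\tilde z)\in E\times\tilde E\mid\lambda(z)=\tilde\lambda(\tilde z)\}$, a submanifold of $E\times\tilde E$ containing $Z_{\hat E}$. There are an open neighborhood $W_\Gamma$ of $Z_{\hat E}$ in $\Gamma$ and an open neighborhood $V_\Gamma$ of the diagonal $M_2$ in $M^2$ such that $(z,\tilde z)\mapsto(\pi(z),\tilde\pi(\tilde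 z))$ is a diffeomorphism of $W_\Gamma$ onto $V_\Gamma$. Fix these; $\gamma:V_\Gamma\to M$ is the unique mapping with $\gamma(\pi(z),\tilde\pi(\tilde z))=\lambda(z)=\tilde\lambda(\tilde z)$ for $(z,\tilde z)\in W_\Gamma$. The form $\Omega:=\gamma^*\omega$ is a closed form on $V_\Gamma$ of type $(1,1)$ with respect to the product structure on $M^2$. Calabi functions. $M_n$ denotes the diagonal of $M^n$. Let $X,Y$ be manifolds, $W'\subset X\times Y$ open, $\Omega$ a closed $(1,1)$-form on $W'$, and $(C_{ij})$ a $k\times l$-matrix with all row sums and column sums zero. Let $\pi_{ij}:X^k\times Y^l\to X\times Y$ send $(x_1,\ldots,x_k,y_1,\ldots,y_l)$ to $(x_i,y_j)$, let $i(x,y)=(x,\ldots,x,y,\ldots,y)$, let $\hat W':=\bigcap_{i,j}\pi_{ij}^{-1}(W')$, $\hat\Omega:=\sum_{i,j}C_{ij}\pi_{ij}^*\Omega$, and let $d=d_x+d_y$ be the decomposition of the exterior derivative on $\hat W'$ with respect to the product $X^k\times Y^l$. A function $C$ on a neighborhood $W_0$ of $i(W')$ in $\hat W'$ is a Calabi function associated with $\Omega$ and $(C_{ij})$ if $\hat\Omega=d_xd_yC$ and $C$ vanishes on $(X_k\times Y^l)\cap W_0$ and on $(X^k\times Y_l)\cap W_0$, where $X_k,Y_l$ are the diagonals of $X^k,Y^l$. Such functions exist and define a unique germ around $i(W')$. The cyclic $n$-point Calabi function: take $X=Y=M$, $W'=V_\Gamma$, $\Omega=\gamma^*\omega$, $k=l=n$,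 and $C_{ij}=1$ if $j=i+1$ ($1\le i\le n-1$) or $(i,j)=(n,1)$, $C_{ij}=-1$ if $i=j$, and $C_{ij}=0$ otherwise; let $C_n$ be an associated Calabi function and put $\mathcal{C}_n(x_1,\ldots,x_n):=C_n(x_1,\ldots,x_n,x_1,\ldots,x_n)$, defined on a neighborhood of $M_n$ in $M^n$. Locally, every $x_0\in M$ has a contractible neighborhood $U$ such that, for any potential $\Phi(x,y)$ of $\Omega$ on $U^2$ (i.e. $\Omega=d_xd_y\Phi$), on $U^n$ one has $$\mathcal{C}_n(x_1,\ldots,x_n)=\Phi(x_1,x_2)-\Phi(x_2,x_2)+\Phi(x_2,x_3)-\Phi(x_3,x_3)+\cdots-\Phi(x_n,x_n)+\Phi(x_n,x_1)-\Phi(x_1,x_1).$$ *)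

(* Defs.v *)
From HB Require Import structures.
From mathcomp Require Import all_boot all_order all_algebra.
From mathcomp Require Import all_classical all_reals all_analysis.

Set Implicit Arguments.
Unset Strict Implicit.
Unset Printing Implicit Defensive.
Import Order.TTheory GRing.Theory Num.Theory.
Import numFieldNormedType.Exports.

Local Open Scope classical_set_scope.
Local Open Scope ring_scope.

Section Smooth.
Context {R : realType} {V W : normedModType R}.

(* On a finite-dimensional V this is the usual notion of a C^k map on the open
   set A. *)
Fixpoint Ck (k : nat) (A : set V) (f : V -> W) : Prop :=
  match k with
  | 0%N => forall a, A a -> {for a, continuous f}
  | k'.+1 => (forall a, A a -> differentiable f a) /\
             (forall u, Ck k' A (fun a => 'd f a u))
  end.

Definition Cinfty (A : set V) (f : V -> W) : Prop := forall k, Ck k A f.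

End Smooth.

(* An atlas on T modelled on V, indexed by the points of T: [chart p] is a chart
   around p, defined on [dom p], and [param p] is its inverse.  Every manifold
   has such an atlas (choose one chart around each point), and its smooth
   structure is determined by it.  The maps are total functions whose values
   matter only on [dom p], resp. on its image.  As there is a preferred chart at
   each point, a tangent vector at p is represented by its coordinates in
   [chart p], so that every tangent space is V. *)
Record atlas (R : realType) (V : normedModType R) (T : Type) := Atlas {
  adom : T -> set T;
  achart : T -> T -> V;
  aparam : T -> V -> T }.

(* Atlas data only; the axioms are in [is_manifold]. *)
Record charted (R : realType) (V : normedModType R) := Charted {
  carrier :> Type;
  atlas_of : atlas V carrier }.

Section ChartedBasics.
Context {R : realType} {V : normedModType R} (T : charted V).

Definition dom : T -> set T := adom (atlas_of T).
Definition chart : T -> T -> V := achart (atlas_of T).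
Definition param : T -> V -> T := aparam (atlas_of T).

Definition mopen (U : set T) : Prop :=
  forall p, open (chart p @` (U `&` dom p)).

Definition open_nbhd_of (Z U : set T) : Prop := mopen U /\ Z `<=` U.

(* U is an open neighbourhood of Z in the subspace S. *)
Definition open_nbhd_in (S Z U : set T) : Prop :=
  (exists2 O, mopen O & U = O `&` S) /\ Z `<=` U.

Definition is_manifold : Prop :=
  [/\ forall p, dom p p,
      forall p x, dom p x -> param p (chart p x) = x,
      forall p q, open (chart p @` (dom p `&` dom q)) /\
                  Cinfty (chart p @` (dom p `&` dom q)) (chart q \o param p),
      forall p q, p <> q ->
        exists A B, [/\ mopen A, mopen B, A p, B q & A `&` B = set0]
    & exists B : nat -> set T, (forall i, mopen (B i)) /\
        forall U p, mopen U -> U p -> exists2 i, B i p & B i `<=` U].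

End ChartedBasics.

Section Constructions.
Context {R : realType}.

Definition model (V : normedModType R) : charted V :=
  Charted (Atlas (fun=> setT) (fun=> id) (fun=> id)).

Definition mprod {V W : normedModType R} (S : charted V) (T : charted W) :
    charted (V * W)%type :=
  @Charted R (V * W)%type (S * T)%type (Atlas
    (fun p => dom p.1 `*` dom p.2)
    (fun p x => (chart p.1 x.1, chart p.2 x.2))
    (fun p a => (param p.1 a.1, param p.2 a.2))).

Definition mpow (k d : nat) (T : charted 'rV[R]_d) : charted 'M[R]_(k, d) :=
  @Charted R 'M[R]_(k, d) ('I_k -> T) (Atlas
    (fun p => [set x | forall i, dom (p i) (x i)])
    (fun p x => \matrix_i chart (p i) (x i))
    (fun p A i => param (p i) (row i A))).

(* The cotangent bundle.  A covector at q is given by its coefficients xi in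
   [chart q]; its coefficients in [chart p] are those of the functional
   u |-> xi (d(chart q \o param p) u). *)
Definition cotangent (d : nat) (M : charted 'rV[R]_d) : charted 'rV[R]_(d + d) :=
  @Charted R 'rV[R]_(d + d) (M * 'rV[R]_d)%type (Atlas
    (fun p => [set q | dom p.1 q.1])
    (fun p q => row_mx (chart p.1 q.1)
       (q.2 *m ('J (chart q.1 \o param p.1) (chart p.1 q.1))^T))
    (fun p A => let q := param p.1 (lsubmx A) in
       (q, rsubmx A *m ('J (chart p.1 \o param q) (chart q q))^T))).

Definition covec {d : nat} {M : charted 'rV[R]_d} (xi : cotangent M)
  (u : 'rV[R]_d) : R := (u *m xi.2^T) 0 0.

End Constructions.

Section Maps.
Context {R : realType} {V W : normedModType R} {S : charted V} {T : charted W}.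

(* Smoothness on an arbitrary subset A: locally, f has a smooth extension to an
   open set.  On an open set, resp. an embedded submanifold, this is ordinary
   smoothness, so embedded submanifolds are handled as subsets. *)
Definition smooth_on (A : set S) (f : S -> T) : Prop :=
  forall p, A p -> exists O g,
    [/\ mopen O, O p, O `<=` dom p `&` g @^-1` dom (f p),
        Cinfty (chart p @` O) (chart (f p) \o g \o param p)
      & forall x, A x -> O x -> g x = f x].

Definition dmap (f : S -> T) (p : S) : V -> W :=
  'd (chart (f p) \o f \o param p) (chart p p).

End Maps.

Section Submanifolds.
Context {R : realType}.

Definition diffeo {V W : normedModType R} {S : charted V} {T : charted W}
    (A : set S) (B : set T) (f : S -> T) : Prop :=
  smooth_on A f /\
  exists g : T -> S, [/\ smooth_on B g,
    forall x, A x -> B (f x) /\ g (f x) = x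
  & forall y, B y -> A (g y) /\ f (g y) = y].

Definition submanifold {V : normedModType R} {T : charted V} (k : nat)
    (A : set T) : Prop :=
  forall p, A p -> exists (O : set T) (D : set 'rV[R]_k) (h : T -> model 'rV[R]_k),
    [/\ mopen O, O p, open D & diffeo (A `&` O) (D : set (model 'rV[R]_k)) h].

(* Velocities at p of smooth curves in A; for an embedded submanifold A this is
   the tangent space of A at p. *)
Definition tangent {V : normedModType R} {T : charted V} (A : set T) (p : T) :
    set V :=
  [set u | exists c : model R^o -> T,
    [/\ smooth_on setT c, c 0 = p, forall t, A (c t) & dmap c 0 1 = u]].

End Submanifolds.

Section Forms.
Context {R : realType}.

Definition form1 {V : normedModType R} (T : charted V) : Type := T -> V -> R.
Definition form2 {V : normedModType R} (T : charted V) : Type := T -> V -> V -> R.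

Definition pull1 {V W : normedModType R} {S : charted V} {T : charted W}
    (f : S -> T) (phi : form1 T) : form1 S :=
  fun p u => phi (f p) (dmap f p u).

Definition pull2 {V W : normedModType R} {S : charted V} {T : charted W}
    (f : S -> T) (w : form2 T) : form2 S :=
  fun p u v => w (f p) (dmap f p u) (dmap f p v).

Section OneManifold.
Context {V : normedModType R} {T : charted V}.

Definition local1 (p : T) (phi : form1 T) : form1 (model V) :=
  pull1 (param p : model V -> T) phi.
Definition local2 (p : T) (w : form2 T) : form2 (model V) :=
  pull2 (param p : model V -> T) w.

Definition smooth_form1 (phi : form1 T) : Prop :=
  (forall p, linear (phi p : V -> R^o)) /\
  (forall p u, Cinfty (chart p @` dom p) (fun a => local1 p phi a u : R^o)).

Definition smooth_form2 (w : form2 T) : Prop :=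
  [/\ forall p u, linear (w p u : V -> R^o),
      forall p u, w p u u = 0,
      forall p u v, w p u v = - w p v u
    & forall p u v, Cinfty (chart p @` dom p) (fun a => local2 p w a u v : R^o)].

Definition dfun (h : T -> R) : form1 T := dmap (h : T -> model R^o).

Definition dform1 (phi : form1 T) : form2 T := fun p u v =>
  'd (fun a => local1 p phi a v : R^o) (chart p p) u -
  'd (fun a => local1 p phi a u : R^o) (chart p p) v.

Definition dform2 (w : form2 T) (p : T) (u1 u2 u3 : V) : R :=
  'd (fun a => local2 p w a u2 u3 : R^o) (chart p p) u1 -
  'd (fun a => local2 p w a u1 u3 : R^o) (chart p p) u2 +
  'd (fun a => local2 p w a u1 u2 : R^o) (chart p p) u3.

Definition symplectic (w : form2 T) : Prop :=
  [/\ smooth_form2 w, forall p u1 u2 u3, dform2 w p u1 u2 u3 = 0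
    & forall p u, (forall v, w p u v = 0) -> u = 0].

End OneManifold.
End Forms.

Section Bundles.
Context {R : realType} {d : nat}.

Record bundle (M : charted 'rV[R]_d) (r : nat) := Bundle {
  fiber : M -> lmodType R;
  total_atlas : atlas 'rV[R]_(d + r) {x : M & fiber x} }.

Definition total {M : charted 'rV[R]_d} {r : nat} (E : bundle M r) :
    charted 'rV[R]_(d + r) := Charted (total_atlas E).

Definition proj {M : charted 'rV[R]_d} {r : nat} {E : bundle M r}
  (z : total E) : M := tag z.

Definition zsec {M : charted 'rV[R]_d} {r : nat} (E : bundle M r) (x : M) :
  total E := Tagged (fiber E) (0 : fiber E x).

Definition fiber_set {M : charted 'rV[R]_d} {r : nat} (E : bundle M r) (x : M) :
  set (total E) := [set z | proj z = x].

Definition vector_bundle {M : charted 'rV[R]_d} {r : nat} (E : bundle M r) :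
    Prop :=
  [/\ is_manifold (total E), smooth_on setT (@proj M r E)
    & forall x, exists (U : set M) (h : total E -> mprod M (model 'rV[R]_r)),
        [/\ mopen U, U x,
            diffeo (proj @^-1` U) [set q : mprod M (model 'rV[R]_r) | U q.1] h,
            forall z, U (proj z) -> (h z).1 = proj z
          & forall y, U y ->
              linear (fun v : fiber E y => (h (Tagged (fiber E) v)).2)]].

End Bundles.

Arguments fiber_set {R d M r} E x.

Coercion total : bundle >-> charted.

Section LagrangianFields.
Context {R : realType} {m : nat} {M : charted 'rV[R]_(2 * m)}.

Definition lagrangian (omega : form2 M) (L : set M) : Prop :=
  submanifold m L /\
  forall p u v, L p -> tangent L p u -> tangent L p v -> omega p u v = 0.

Definition leaf {E : bundle M m} (lam : E -> M) (x : M) : set M :=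
  lam @` fiber_set E x.

Definition lagrangian_field (omega : form2 M) (E : bundle M m) (lam : E -> M) :
    Prop :=
  [/\ vector_bundle E,
      [/\ smooth_on setT lam, forall y, exists z, lam z = y
        & forall z v, exists u, dmap lam z u = v],
      forall x, diffeo (fiber_set E x) (leaf lam x) lam /\
                lagrangian omega (leaf lam x)
    & forall x, lam (zsec E x) = x].

Definition transversal_fields {E E' : bundle M m} (lam : E -> M)
    (lam' : E' -> M) : Prop :=
  forall x w, exists u v,
    [/\ tangent (leaf lam x) x u, tangent (leaf lam' x) x v & w = u + v].

Definition horizontal {E : bundle M m} (phi : form1 E) : Prop :=
  forall z u, dmap (@proj R _ M m E) z u = 0 -> phi z u = 0.

(* phi is the horizontal primitive of lam^* omega - proj^* omega that vanishes on
   the zero section. *)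
Definition field_form (omega : form2 M) {E : bundle M m} (lam : E -> M)
    (phi : form1 E) : Prop :=
  [/\ smooth_form1 phi, horizontal phi, forall x u, phi (zsec E x) u = 0
    & forall z u v,
        pull2 lam omega z u v - pull2 (@proj R _ M m E) omega z u v =
        dform1 phi z u v].

Section TwoFields.
Context {E E' : bundle M m}.

Definition Ehat : set (mprod E E') := [set z | proj z.1 = proj z.2].

Definition Zhat : set (mprod E E') :=
  [set z | exists x, z = (zsec E x, zsec E' x)].

(* [tangent Ehat z] is the tangent space of the submanifold [Ehat]; the left-hand
   side is the pullback of [chi z] by the bundle projection. *)
Definition chi_map (phi : form1 E) (phi' : form1 E')
    (chi : mprod E E' -> cotangent M) : Prop :=
  forall z, Ehat z -> (chi z).1 = proj z.1 /\
    forall w, tangent Ehat z w ->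
      covec (chi z) (dmap (fun y : mprod E E' => proj y.1) z w) =
      pull1 (snd : mprod E E' -> E') phi' z w -
      pull1 (fst : mprod E E' -> E) phi z w.

(* The target map lam' comes first, the source map lam second. *)
Definition lam_pair (lam : E -> M) (lam' : E' -> M) (z : mprod E E') :
  mprod M M := (lam' z.2, lam z.1).

Definition proj_pair (z : mprod E E') : mprod M M := (proj z.1, proj z.2).

Definition Gamma (lam : E -> M) (lam' : E' -> M) : set (mprod E E') :=
  [set z | lam z.1 = lam' z.2].

End TwoFields.

Definition zero_section : set (cotangent M) := [set a | a.2 = 0].

Definition diagonal2 : set (mprod M M) := [set p | p.1 = p.2].

(* The n-cycles of the groupoid on V with source and target the components f2, f1
   of f; [ordS] is the cyclic successor. *)
Definition cycles (n : nat) (V : set (cotangent M))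
    (f : cotangent M -> mprod M M) : set (mpow n (cotangent M)) :=
  [set a | forall k, V (a k) /\ (f (a k)).2 = (f (a (ordS k))).1].

End LagrangianFields.

Section Calabi.
Context {R : realType} {a b : nat} {X : charted 'rV[R]_a} {Y : charted 'rV[R]_b}
  {k l : nat}.

Local Notation P := (mprod (mpow k X) (mpow l Y)).

(* The decomposition d = d_x + d_y on X^k x Y^l: d_y h is the (0,1)-part of dh, and d_x d_y h is the
   (1,1)-part of d(d_y h). *)
Definition dy (h : P -> R) : form1 P := fun p w => dfun h p (0, w.2).

Definition dxdy (h : P -> R) : form2 P := fun p w w' =>
  dform1 (dy h) p (w.1, 0) (0, w'.2) + dform1 (dy h) p (0, w.2) (w'.1, 0).

Definition pi_ (i : 'I_k) (j : 'I_l) (p : P) : mprod X Y := (p.1 i, p.2 j).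

Definition calabi (W' : set (mprod X Y)) (Omega : form2 (mprod X Y))
    (c : 'M[R]_(k, l)) (W0 : set P) (C : P -> R) : Prop :=
  [/\ open_nbhd_of [set p : P | exists2 q, W' q & p = (fun=> q.1, fun=> q.2)] W0,
      forall p i j, W0 p -> W' (pi_ i j p),
      smooth_on W0 (C : P -> model R^o),
      forall p w w', W0 p ->
        \sum_i \sum_j c i j * pull2 (pi_ i j) Omega p w w' = dxdy C p w w'
    & forall p, W0 p ->
        (forall i i', p.1 i = p.1 i') \/ (forall j j', p.2 j = p.2 j') ->
        C p = 0].

End Calabi.

(* For n >= 2 the off-diagonal entries 1 are at (i, i+1) and (n, 1). *)
Definition cyclic_matrix (R : realType) (n : nat) : 'M[R]_n :=
  \matrix_(i, j) if j == ordS i then 1 else if i == j then -1 else 0.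

(* Main.v *)
Require Import Defs.
From HB Require Import structures.
From mathcomp Require Import all_boot all_order all_algebra.
From mathcomp Require Import all_classical all_reals all_analysis.

Set Implicit Arguments.
Unset Strict Implicit.
Unset Printing Implicit Defensive.
Import Order.TTheory GRing.Theory Num.Theory.
Import numFieldNormedType.Exports.

Local Open Scope classical_set_scope.
Local Open Scope ring_scope.

(* Let r = (z, z') be the inverse of the projection of W_Gamma to V_Gamma, so
   that z(x, y) lies over x, z'(x, y) over y, and gamma = lam z = lam' z'.
   Pulling back lam^* omega - pi^* omega = d phi by z and its analogue by z', and
   using that phi and phi' are horizontal, one finds that the mixed derivatives
   of alpha = z^* phi in y and of beta = z'^* phi' in x are given by
   Omega = gamma^* omega.  The same holds for the partial derivatives of C, up to
   the weights C_ij; since C vanishes on the partial diagonals, integrating along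
   a chart segment that ends on the diagonal gives
     d_{x_k} C = - sum_j C_kj alpha(x_k, y_j),
     d_{y_k} C = sum_i C_ik beta(x_i, y_k),
   hence d_k C_n = beta(x_{k-1}, x_k) - alpha(x_k, x_{k+1}).  This is the value of
   chi at (z(x_k, x_{k+1}), z'(x_{k-1}, x_k)), and cycles near the zero section
   are exactly the tuples of such values, because the condition
   s(a_k) = t(a_{k+1}) says that (z_k, z'_{k+1}) lies in Gamma. *)

(** * Smooth maps between normed modules *)

(** A tangent vector is written in the preferred chart of its base point, and that chart jumps
    arbitrarily from point to point, so a form or a partial derivative cannot be differentiated over
    the manifold as it stands. Everything is therefore tested on a product of two curves, one in
    each copy of M^n: there [C] and the pulled-back forms become functions on the plane, whose mixed
    derivatives are compared by Schwarz's theorem. The constant of integration vanishes at the end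
    of the segment for two reasons: [C] is zero on the whole partial diagonal, hence so is its
    derivative along it, and the weighted sum of form values is there one value times a row or
    column sum. The weights -1 of the cyclic matrix only contribute alpha(x, x) and beta(x, x),
    which are zero because the inverse [r] sends the diagonal to the zero sections. Finally, [W0] is
    merely an open neighbourhood and need not contain any given segment; this forces [N] to consist
    of tuples inside a chart ball small enough that all pairs of its tuples lie in [W0]. *)

Class findim (R : realType) (V : normedModType R) : Prop := findimP :
  exists (I : finType) (e : I -> V) (l : I -> {linear V -> R^o}),
    (forall i, continuous (l i)) /\ forall v, v = \sum_i l i v *: e i.

Section CkTheory.
Context {R : realType}.
Implicit Types U V W : normedModType R.

(** The remainder in the first-order expansion sees only the germ at [a]; uniqueness of the
    differential does the rest. *)
Lemma diff_near V W (f g : V -> W) (a : V) :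
  (\forall x \near a, f x = g x) -> differentiable f a ->
  differentiable g a /\ 'd g a = 'd f a :> (V -> W).
Proof.
move=> fg df.
have fga : f a = g a by exact: nbhs_singleton fg.
have dg : g \o shift a = cst (g a) + 'd f a +o_ 0 id.
  apply/eqaddoP => e e0.
  have /eqaddoP /(_ _ e0) := diff_locally df.
  have : \forall x \near 0, f (shift a x) = g (shift a x).
    by move: fg; rewrite (near_shift 0) subr0.
  by apply: filterS2 => x /= fgx; rewrite !fctE /= -fgx -fga.
have eg : 'd g a = 'd f a :> (V -> W).
  by apply: diff_unique => //; exact: diff_continuous.
split=> //; apply/diff_locallyP; rewrite eg; split=> //.
exact: diff_continuous.
Qed.

Lemma Ck_weaken V W k (A : set V) (f : V -> W) : Ck k.+1 A f -> Ck k A f.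
Proof.
elim: k f => [|k IH] f [df Df]; first by move=> a /df /differentiable_continuous.
by split=> // u; exact: IH.
Qed.

Lemma Ck_sub V W k (A B : set V) (f : V -> W) : B `<=` A -> Ck k A f -> Ck k B f.
Proof.
move=> BA; elim: k f => [|k IH] f /= => [cf a /BA|[df Df]]; first exact: cf.
by split=> [a /BA/df //|u]; exact: IH.
Qed.

Lemma Ck_congr V W k (A : set V) (f g : V -> W) : open A ->
  (forall a, A a -> f a = g a) -> Ck k A f -> Ck k A g.
Proof.
move=> oA.
have nA (f' g' : V -> W) (fg : forall a, A a -> f' a = g' a) a :
    A a -> \forall x \near a, f' x = g' x.
  by move=> Aa; apply: filterS (open_nbhs_nbhs (conj oA Aa)) => x /fg.
elim: k f g => [|k IH] f g fg /= => [cf a Aa|[df Df]].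
  change (g x @[x --> a] --> g a); rewrite -(fg _ Aa).
  apply: cvg_trans (cf _ Aa).
  by apply: near_eq_cvg; apply: nA.
split=> [a Aa|u]; first by have [] := diff_near (nA _ _ fg _ Aa) (df _ Aa).
apply: IH (Df u) => a Aa.
exact: esym (congr1 (@^~ u) (diff_near (nA _ _ fg _ Aa) (df _ Aa)).2).
Qed.

Lemma Ck_cst V W k (A : set V) (c : W) : Ck k A (cst c).
Proof.
elim: k c => [|k IH] c /=; first by move=> a _; exact: cst_continuous.
split=> [a _|u]; first exact: differentiable_cst.
by rewrite (_ : (fun _ => _) = cst 0) //; apply/funext => a; rewrite diff_cst.
Qed.

Lemma Ck_lin V W k (A : set V) (L : {linear V -> W}) : continuous L -> Ck k A L.
Proof.
move=> cL; case: k => [|k] /=; first by move=> a _; exact: cL.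
split=> [a _|u]; first exact: linear_differentiable.
rewrite (_ : (fun _ => _) = cst (L u)); first exact: Ck_cst.
by apply/funext => a; rewrite diff_lin.
Qed.

Lemma Ck_add V W k (A : set V) (f g : V -> W) : open A ->
  Ck k A f -> Ck k A g -> Ck k A (fun x => f x + g x).
Proof.
move=> oA; elim: k f g => [|k IH] f g /= => [cf cg a Aa|[df Df] [dg Dg]].
  by apply: cvgD; [exact: cf|exact: cg].
split=> [a Aa|u]; first by apply: differentiableD; [exact: df|exact: dg].
apply: Ck_congr (IH _ _ (Df u) (Dg u)) => // a Aa.
exact: esym (congr1 (@^~ u) (diffD (df _ Aa) (dg _ Aa))).
Qed.

Lemma Ck_sum V W k (A : set V) (I : Type) (r : seq I) (f : I -> V -> W) :
  open A -> (forall i, Ck k A (f i)) -> Ck k A (fun x => \sum_(i <- r) f i x).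
Proof.
move=> oA Cf; elim: r => [|i r IH].
  apply: (Ck_congr oA (f := cst 0)) => [a _|]; last exact: Ck_cst.
  by rewrite big_nil.
apply: (Ck_congr oA (f := fun x => f i x + \sum_(j <- r) f j x)).
  by move=> a _; rewrite big_cons.
exact: Ck_add.
Qed.

Lemma Ck_lin_comp U V W k (A : set U) (L : {linear V -> W}) (f : U -> V) :
  open A -> continuous L -> Ck k A f -> Ck k A (L \o f).
Proof.
move=> oA cL; elim: k f => [|k IH] f /= => [cf a Aa|[df Df]].
  by apply: continuous_comp; [exact: cf|exact: cL].
have dL a : differentiable L a by exact: linear_differentiable.
split=> [a Aa|u]; first by apply: differentiable_comp; [exact: df|].
apply: Ck_congr (IH _ (Df u)) => // a Aa.
have := congr1 (@^~ u) (diff_comp (df _ Aa) (dL _)).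
by rewrite [RHS]/= (diff_lin _ cL).
Qed.

(** The Leibniz rule leaves one factor undifferentiated, at order [k.+1] where the induction
    hypothesis wants order [k]; hence [Ck_weaken]. *)
Lemma Ck_mul V k (A : set V) (f g : V -> R^o) : open A ->
  Ck k A f -> Ck k A g -> Ck k A (fun x => f x * g x : R^o).
Proof.
move=> oA; elim: k f g => [|k IH] f g.
  by move=> cf cg a Aa; apply: cvgM; [exact: cf|exact: cg].
move=> Cf Cg; have [[df Df] [dg Dg]] := (Cf, Cg).
split=> [a Aa|u].
  by apply: (@differentiableM _ _ (f : V -> R)); [exact: df|exact: dg].
apply: (Ck_congr oA (f := fun x => f x * 'd g x u + g x * 'd f x u)).
  move=> a Aa.
  exact: esym (congr1 (@^~ u) (diffM (df _ Aa) (dg _ Aa))).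
apply: (Ck_add oA); first exact: IH (Ck_weaken Cf) (Dg u).
exact: IH (Ck_weaken Cg) (Df u).
Qed.

Lemma Ck_scalel V W k (A : set V) (f : V -> R^o) (w : W) : open A ->
  Ck k A f -> Ck k A (fun x => f x *: w).
Proof.
move=> oA; elim: k f => [|k IH] f => [cf a Aa|[df Df]].
  by apply: cvgZr_tmp; exact: cf.
split=> [a Aa|u]; first by apply: (@differentiableZl _ _ _ (f : V -> R)); exact: df.
apply: (Ck_congr oA) (IH _ (Df u)) => a Aa.
exact: esym (congr1 (@^~ u) (diffZl w (df _ Aa))).
Qed.

Lemma Ck_scale V W {fW : findim W} k (A : set V) (f : V -> R^o) (g : V -> W) :
  open A -> Ck k A f -> Ck k A g -> Ck k A (fun x => f x *: g x).
Proof.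
have [n [e [l [cl el]]]] := fW; move=> oA Cf Cg.
apply: (Ck_congr oA (f := fun x => \sum_i (f x * l i (g x)) *: e i)).
  move=> a Aa; rewrite {2}(el (g a)) scaler_sumr.
  by apply: eq_bigr => i _; rewrite scalerA.
apply: (Ck_sum _ oA) => i; apply: (Ck_scalel _ oA); apply: (Ck_mul oA Cf).
exact: Ck_lin_comp oA (cl i) Cg.
Qed.

(** [Ck] differentiates in one fixed direction at a time, whereas the chain rule gives ['d g (f x)]
    in the direction ['d f x u], which moves with [x]. Expanding it over the finite family of
    [findim] leaves fixed directions [e i] with coefficients of class C^k; this is the reason for
    that class. *)
Lemma Ck_comp U V W {fV : findim V} {fW : findim W} k (A : set U) (B : set V)
    (f : U -> V) (g : V -> W) : open A -> (forall a, A a -> B (f a)) ->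
  Ck k A f -> Ck k B g -> Ck k A (g \o f).
Proof.
have [n [e [l [cl el]]]] := fV.
move=> oA AB; elim: k f g AB => [|k IH] f g AB.
  move=> cf cg a Aa; apply: continuous_comp; first exact: cf.
  by apply: cg; exact: AB.
move=> Cf Cg; have [[df Df] [dg Dg]] := (Cf, Cg).
split=> [a Aa|u].
  by apply: differentiable_comp; [exact: df|exact/dg/AB].
apply: (Ck_congr oA (f := fun x => \sum_i l i ('d f x u) *: 'd g (f x) (e i))).
  move=> a Aa; rewrite (diff_comp (df _ Aa) (dg _ (AB _ Aa))) /=.
  by rewrite {2}(el ('d f a u)) linear_sum; apply: eq_bigr => i _; rewrite linearZ.
apply: (Ck_sum _ oA) => i; apply: (Ck_scale oA).
  exact: Ck_lin_comp oA (cl i) (Df u).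
exact: IH AB (Ck_weaken Cf) (Dg (e i)).
Qed.

End CkTheory.

(** * Smoothness at a point *)

Section Smooth.
Context {R : realType}.
Implicit Types U V W : normedModType R.

Definition pack_linear V W (f : V -> W) (hf : linear f) : {linear V -> W} :=
  HB.pack f (GRing.isLinear.Build _ _ _ _ f hf).

#[export] Instance findim_R : findim (R^o : normedModType R).
Proof.
have hl : linear (idfun : R^o -> R^o) by move=> a u v.
exists unit, (fun=> 1), (fun=> pack_linear hl); split=> [i x|v]; first exact: cvg_id.
by rewrite (big_pred1 tt) => [|[] //]; rewrite /= [_ *: _]mulr1.
Qed.

Lemma coord_linear m n i j : linear (fun M : 'M[R]_(m, n) => M i j : R^o).
Proof. by move=> a u v; rewrite !mxE. Qed.

#[export] Instance findim_mx m n : findim ('M[R]_(m, n) : normedModType R).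
Proof.
exists ('I_m * 'I_n)%type, (fun p => delta_mx p.1 p.2).
exists (fun p => pack_linear (@coord_linear m n p.1 p.2)).
split=> [p|v]; first exact: coord_continuous.
by rewrite {1}(matrix_sum_delta v) pair_big.
Qed.

Lemma fst_linear V W : linear (fst : V * W -> V). Proof. by []. Qed.
Lemma snd_linear V W : linear (snd : V * W -> W). Proof. by []. Qed.

Lemma inl_linear V W : linear (fun v => (v, 0) : V * W).
Proof. by move=> a u v; apply: injective_projections; rewrite //= scaler0 addr0. Qed.
Lemma inr_linear V W : linear (fun w => (0, w) : V * W).
Proof. by move=> a u v; apply: injective_projections; rewrite //= scaler0 addr0. Qed.

Lemma comp_linear U V W (f : U -> V) (g : V -> W) : linear f -> linear g ->
  linear (g \o f).
Proof. by move=> lf lg a u v; rewrite /= lf lg. Qed.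

#[export] Instance findim_prod V W {fV : findim V} {fW : findim W} :
  findim ((V * W)%type : normedModType R).
Proof.
have [I [e [l [cl el]]]] := fV; have [J [e' [l' [cl' el']]]] := fW.
exists (I + J)%type,
  (fun i => match i with inl i => (e i, 0) | inr j => (0, e' j) end).
exists (fun i => match i with
  | inl i => pack_linear (comp_linear (@fst_linear V W) (linearP (l i)))
  | inr j => pack_linear (comp_linear (@snd_linear V W) (linearP (l' j))) end).
split=> [[i|j] p|[v w]].
- by apply: (continuous_comp (f := fst)); [exact: cvg_fst|exact: cl].
- by apply: (continuous_comp (f := snd)); [exact: cvg_snd|exact: cl'].
rewrite big_sumType /=.
have E1 : \sum_(i : I) l i v *: ((e i, 0) : V * W) = (\sum_i l i v *: e i, 0).
  rewrite (_ : (_, _) = pack_linear (@inl_linear V W) (\sum_i l i v *: e i)) //.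
  by rewrite linear_sum; apply: eq_bigr => i _; rewrite linearZ.
have E2 : \sum_(j : J) l' j w *: ((0, e' j) : V * W) = (0, \sum_j l' j w *: e' j).
  rewrite (_ : (_, _) = pack_linear (@inr_linear V W) (\sum_i l' i w *: e' i)) //.
  by rewrite linear_sum; apply: eq_bigr => i _; rewrite linearZ.
rewrite E1 E2 -el -el'.
by apply: injective_projections; rewrite /= ?addr0 ?add0r.
Qed.

(** The open set is hidden, so that closure properties hold pointwise without tracking
    intersections, while smoothness still spreads to nearby points ([sm_near]), where derivatives
    have to be compared. *)
Definition sm V W (f : V -> W) (a : V) : Prop :=
  exists A, [/\ open A, A a & Cinfty A f].

Lemma sm_near V W (f : V -> W) a : sm f a -> \forall x \near a, sm f x.
Proof.
move=> [A [oA Aa CA]]; apply: filterS (open_nbhs_nbhs (conj oA Aa)) => x Ax.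
by exists A.
Qed.

Lemma sm_differentiable V W (f : V -> W) a : sm f a -> differentiable f a.
Proof. by move=> [A [oA Aa /(_ 1%N) [df _]]]; exact: df. Qed.

Lemma sm_continuous V W (f : V -> W) a : sm f a -> f x @[x --> a] --> f a.
Proof. by move=> /sm_differentiable /differentiable_continuous. Qed.

Lemma sm_diff V W (f : V -> W) a u : sm f a -> sm (fun x => 'd f x u) a.
Proof.
move=> [A [oA Aa Cf]]; exists A; split=> // k; exact: (Cf k.+1).2.
Qed.

Lemma sm_eq V W (f g : V -> W) a : (\forall x \near a, f x = g x) ->
  sm f a -> sm g a.
Proof.
move=> fg [A [oA Aa Cf]]; have {fg} : nbhs a [set x | f x = g x] by [].
rewrite nbhsE => -[B [oB Ba] fg].
exists (A `&` B); split=> //; first exact: openI.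
move=> k; apply: (Ck_congr (f := f)); first exact: openI.
  by move=> x [_ /fg].
by apply: Ck_sub (Cf k) => x [].
Qed.

Lemma sm_congr V W (f g : V -> W) a : f =1 g -> sm f a -> sm g a.
Proof. by move=> /funext ->. Qed.

Lemma sm_cst V W (c : W) (a : V) : sm (fun=> c) a.
Proof. by exists setT; split=> //; [exact: openT|move=> k; exact: Ck_cst]. Qed.

Lemma sm_lin V W (f : V -> W) a : linear f -> continuous f -> sm f a.
Proof.
move=> lf cf; exists setT; split=> //; [exact: openT|move=> k].
exact: (@Ck_lin _ _ _ k setT (pack_linear lf)).
Qed.

Lemma sm_id V (a : V) : sm id a.
Proof. by apply: sm_lin => // x; exact: cvg_id. Qed.

Lemma sm_comp U V W {fV : findim V} {fW : findim W} (f : U -> V) (g : V -> W) a :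
  sm f a -> sm g (f a) -> sm (fun x => g (f x)) a.
Proof.
move=> sf [B [oB Bfa Cg]]; move: (sf) => [A [oA Aa Cf]].
have : nbhs a (f @^-1` B).
  by apply: (sm_continuous sf); exact: open_nbhs_nbhs.
rewrite nbhsE => -[D [oD Da] DB].
exists (A `&` D); split=> [||k] //; first exact: openI.
apply: (@Ck_comp _ _ _ _ _ _ _ _ B) => //; first exact: openI.
- by move=> x [_ /DB].
- by apply: Ck_sub (Cf k) => x [].
Qed.

Section Two.
Context (V W : normedModType R).
Implicit Types (f g : V -> W) (s t : V -> R^o) (a : V).

Local Lemma sm2 {W1 W2 W3 : normedModType R} (f : V -> W1) (g : V -> W2) (h : V -> W3) a :
  (forall k A, open A -> Ck k A f -> Ck k A g -> Ck k A h) ->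
  sm f a -> sm g a -> sm h a.
Proof.
move=> H [A [oA Aa CA]] [B [oB Ba CB]]; exists (A `&` B); split=> //.
  exact: openI.
move=> k; apply: H; first exact: openI.
  by apply: Ck_sub (CA k) => x [].
by apply: Ck_sub (CB k) => x [].
Qed.

Lemma sm_add f g a : sm f a -> sm g a -> sm (fun x => f x + g x) a.
Proof. by apply: sm2 => k A oA; exact: Ck_add. Qed.

Lemma sm_sum (I : Type) (r : seq I) (f : I -> V -> W) a :
  (forall i, sm (f i) a) -> sm (fun x => \sum_(i <- r) f i x) a.
Proof.
move=> sf; elim: r => [|i r IH].
  by apply: (sm_congr (f := fun=> 0)); [move=> x; rewrite big_nil|exact: sm_cst].
apply: (sm_congr (f := fun x => f i x + \sum_(j <- r) f j x)).
  by move=> x; rewrite big_cons.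
exact: sm_add.
Qed.

Lemma sm_mul s t a : sm s a -> sm t a -> sm (fun x => s x * t x : R^o) a.
Proof. by apply: sm2 => k A oA; exact: Ck_mul. Qed.

Lemma sm_scale {fW : findim W} s f a : sm s a -> sm f a ->
  sm (fun x => s x *: f x) a.
Proof. by apply: sm2 => k A oA; exact: Ck_scale. Qed.

Lemma sm_opp {fW : findim W} f a : sm f a -> sm (fun x => - f x) a.
Proof.
move=> sf; apply: (sm_congr (f := fun x => (-1 : R^o) *: f x)).
  by move=> x; rewrite scaleN1r.
by apply: sm_scale => //; exact: sm_cst.
Qed.

Lemma sm_lin_comp {W' : normedModType R} (L : W -> W') f a :
  linear L -> continuous L -> sm f a -> sm (fun x => L (f x)) a.
Proof.
move=> lL cL [A [oA Aa CA]]; exists A; split=> // k.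
exact: (@Ck_lin_comp _ _ _ _ _ _ (pack_linear lL)).
Qed.

End Two.

Lemma fst_continuous V W : continuous (fst : V * W -> V).
Proof. by move=> p; exact: cvg_fst. Qed.
Lemma snd_continuous V W : continuous (snd : V * W -> W).
Proof. by move=> p; exact: cvg_snd. Qed.

Lemma sm_fst V W (a : V * W) : sm fst a.
Proof. by apply: sm_lin => //; exact: fst_continuous. Qed.
Lemma sm_snd V W (a : V * W) : sm snd a.
Proof. by apply: sm_lin => //; exact: snd_continuous. Qed.

Lemma sm_pair U V W (f : U -> V) (g : U -> W) a : sm f a -> sm g a ->
  sm (fun x => (f x, g x)) a.
Proof.
move=> sf sg; apply: (sm_congr (f := fun x => (f x, 0) + (0, g x))).
  by move=> x; apply: injective_projections; rewrite /= ?addr0 ?add0r.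
apply: sm_add.
  apply: (sm_lin_comp (@inl_linear V W)) sf => x.
  by apply: cvg_pair; [exact: cvg_id|exact: cvg_cst].
apply: (sm_lin_comp (@inr_linear V W)) sg => x.
by apply: cvg_pair; [exact: cvg_cst|exact: cvg_id].
Qed.

Lemma sm_coord m n i j (a : 'M[R]_(m, n)) :
  sm (fun M : 'M[R]_(m, n) => M i j : R^o) a.
Proof. by apply: sm_lin; [exact: coord_linear|exact: coord_continuous]. Qed.

Lemma sm_mx V m n (f : V -> 'M[R]_(m, n)) a :
  (forall i j, sm (fun x => f x i j : R^o) a) -> sm f a.
Proof.
move=> sf.
apply: (sm_congr (f := fun x => \sum_i \sum_j f x i j *: delta_mx i j)).
  by move=> x; rewrite -matrix_sum_delta.
apply: (@sm_sum _ _ _ (index_enum _)) => i.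
apply: (@sm_sum _ _ _ (index_enum _)) => j.
by apply: sm_scale; [exact: sf|exact: sm_cst].
Qed.

Lemma sm_mxcoord V m n (f : V -> 'M[R]_(m, n)) i j a :
  sm f a -> sm (fun x => f x i j : R^o) a.
Proof.
exact: (@sm_lin_comp _ _ _ (fun M : 'M[R]_(m, n) => M i j : R^o) f a
  (@coord_linear m n i j) (@coord_continuous _ m n i j)).
Qed.

Lemma sm_mulmx V m n p (f : V -> 'M[R]_(m, n)) (g : V -> 'M[R]_(n, p)) a :
  sm f a -> sm g a -> sm (fun x => f x *m g x) a.
Proof.
move=> sf sg; apply: sm_mx => i k.
apply: (sm_congr (f := fun x => \sum_j (f x i j * g x j k : R^o))).
  by move=> x; rewrite mxE.
apply: (@sm_sum _ _ _ (index_enum _)) => j.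
by apply: sm_mul; exact: sm_mxcoord.
Qed.

Lemma sm_comp_diff U V W {fV : findim V} {fW : findim W} (f : U -> V) (g : V -> W) a u :
  sm f a -> sm g (f a) -> 'd (fun x => g (f x)) a u = 'd g (f a) ('d f a u).
Proof.
move=> sf sg.
have H := diff_comp (sm_differentiable sf) (sm_differentiable sg).
exact: (congr1 (fun h : U -> W => h u) H).
Qed.

End Smooth.

(** * Symmetry of second derivatives *)

Section Schwarz.
Context {R : realType} {V : normedModType R}.

Lemma diff_line {W : normedModType R} (f : V -> W) (a u : V) (s : R) :
  differentiable f (a + s *: u) ->
  differentiable (fun t : R^o => f (a + t *: u)) s /\
  forall w, 'd (fun t : R^o => f (a + t *: u)) s w = w *: 'd f (a + s *: u) u.
Proof.
move=> df.
have dg : is_diff (s : R^o) (fun t : R^o => a + t *: u) (fun t => 0 + t *: u).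
  exact: (is_diffD (f := cst a)).
have dc : differentiable f ((fun t : R^o => a + t *: u) s) by [].
split=> [|w].
  exact: (differentiable_comp (f := fun t : R^o => a + t *: u) (g := f)).
have H := diff_comp (f := fun t : R^o => a + t *: u) (g := f) (@ex_diff _ _ _ _ _ _
  _ dg) dc.
rewrite [LHS](congr1 (fun h : R^o -> W => h w) H) /=.
by rewrite diff_val add0r linearZ.
Qed.

Lemma MVT_line (f : V -> R^o) (a u : V) (h : R) : 0 < h ->
  (forall s : R, 0 <= s <= h -> differentiable f (a + s *: u)) ->
  exists2 s, 0 < s < h & f (a + h *: u) - f a = h * 'd f (a + s *: u) u.
Proof.
move=> h0 df.
have dl (s : R) : 0 <= s <= h ->
    is_derive s (1 : R) (fun t : R => f (a + t *: u) : R) ('d f (a + s *: u) u).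
  move=> /df /diff_line[dg dE]; split; first exact: diff_derivable.
  by rewrite deriveE // dE scale1r.
have [||c] := @MVT R (fun t : R => f (a + t *: u)) (fun s => 'd f (a + s *: u) u) 0 h h0.
- by move=> x; rewrite in_itv /= => /andP[x0 xh]; apply: dl; rewrite !ltW.
- apply: derivable_within_continuous => x; rewrite in_itv /= => /dl dx.
  exact: ex_derive.
- rewrite in_itv /= scale0r addr0 subr0 => ch E; exists c => //.
  by rewrite E mulrC.
Qed.

(** Mean value theorem in direction [u] for the increment of [f] along [h *: v], then in direction
    [v] for the derivative so obtained. The left side is symmetric in [u] and [v] while the right
    side is not: this is the source of [schwarz_scalar]. *)
Lemma second_difference (f : V -> R^o) (a u v : V) (h : R) : 0 < h ->
  (forall s t : R, 0 <= s <= h -> 0 <= t <= h -> sm f (a + s *: u + t *: v)) ->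
  exists s t, [/\ 0 < s < h, 0 < t < h &
    f (a + h *: u + h *: v) - f (a + h *: u) - (f (a + h *: v) - f a) =
    h * (h * 'd (fun x => 'd f x u) (a + s *: u + t *: v) v)].
Proof.
move=> h0 sf.
have hh : 0 <= h <= h by rewrite lexx ltW.
have h00 : 0 <= (0 : R) <= h by rewrite lexx ltW.
pose F x := f (x + h *: v) - f x.
have dF (s : R) : 0 <= s <= h -> differentiable F (a + s *: u) /\
    'd F (a + s *: u) u = 'd f (a + s *: u + h *: v) u - 'd f (a + s *: u) u.
  move=> sh.
  have d1 : differentiable f (a + s *: u + h *: v).
    exact/sm_differentiable/sf.
  have d0 : differentiable f (a + s *: u).
    by have /sm_differentiable := sf _ 0 sh h00; rewrite scale0r addr0.
  have dt : is_diff (a + s *: u) (fun x : V => x + h *: v) (id + cst 0).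
    exact: (is_diffD (f := id) (g := cst (h *: v))).
  have d1' := differentiable_comp (@ex_diff _ _ _ _ _ _ _ dt) d1.
  split; first exact: (differentiableB (f := f \o (fun x : V => x + h *: v))).
  have H := diffB (f := f \o (fun x : V => x + h *: v)) d1' d0.
  rewrite [LHS](congr1 (fun h : V -> R^o => h u) H) /=.
  have H' := diff_comp (@ex_diff _ _ _ _ _ _ _ dt) d1.
  rewrite [X in X - _](congr1 (fun h : V -> R^o => h u) H') /=.
  by rewrite diff_val /= fctE addr0.
have [s|s sh ] := @MVT_line F a u h h0.
  by move=> /dF[].
have sh' : 0 <= s <= h by case/andP: sh => *; rewrite !ltW.
rewrite {1 2}/F (dF _ sh').2 (addrAC a) => ->.
have [t th|t th] := @MVT_line (fun x => 'd f x u) (a + s *: u) v h h0.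
  exact/sm_differentiable/sm_diff/sf.
by move=> ->; exists s, t.
Qed.

Lemma schwarz_scalar (f : V -> R^o) (a u v : V) : sm f a ->
  'd (fun x => 'd f x u) a v = 'd (fun x => 'd f x v) a u.
Proof.
move=> sf; apply/eqP; apply: contraT => neq.
set D1 := fun x => 'd (fun x => 'd f x u) x v.
set D2 := fun x => 'd (fun x => 'd f x v) x u.
(* Half of the supposed gap: near [a] each mixed derivative moves by less than this, yet the two
   take a common value at nearby points. *)
have e0 : 0 < `|D1 a - D2 a| / 2 by rewrite divr_gt0 // normr_gt0 subr_eq0.
have c1 : \forall x \near a, `|D1 a - D1 x| < `|D1 a - D2 a| / 2.
  have /cvgrPdist_lt := sm_continuous (sm_diff v (sm_diff u sf)); exact.
have c2 : \forall x \near a, `|D2 a - D2 x| < `|D1 a - D2 a| / 2.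
  have /cvgrPdist_lt := sm_continuous (sm_diff u (sm_diff v sf)); exact.
pose P x := [/\ sm f x, `|D1 a - D1 x| < `|D1 a - D2 a| / 2 &
  `|D2 a - D2 x| < `|D1 a - D2 a| / 2].
have nP : \forall x \near a, P x.
  near=> x; split; near: x => //; exact: sm_near.
have /nbhs_ballP[d /= d0 dP] : \forall p \near ((0, 0) : R^o * R^o),
    P (a + p.1 *: u + p.2 *: v).
  have : (a + p.1 *: u + p.2 *: v) @[p --> ((0, 0) : R^o * R^o)] -->
      a + (0 : R) *: u + (0 : R) *: v.
    apply: cvgD; first apply: cvgD; first exact: cvg_cst.
      by apply: cvgZr_tmp; exact: (cvg_fst (F := nbhs (0 : R^o))).
    by apply: cvgZr_tmp; exact: (cvg_snd (G := nbhs (0 : R^o))).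
  by apply; rewrite !scale0r !addr0.
(* The closed square of side [d / 2] lies inside the open ball of radius [d]. *)
have h0 : 0 < d / 2 by rewrite divr_gt0.
have hd : d / 2 < d by rewrite ltr_pdivrMr // ltr_pMr // ltr1n.
have PP (s t : R) : 0 <= s <= d / 2 -> 0 <= t <= d / 2 -> P (a + s *: u + t *: v).
  move=> /andP[s0 sh] /andP[t0 th]; apply: (dP (s, t)).
  by split; rewrite /ball /= sub0r normrN ger0_norm // (le_lt_trans _ hd).
have [s t sh th|s [t [/andP[s0 sh] /andP[t0 th] E]]] :=
  @second_difference f a u v _ h0; first by have [] := PP s t sh th.
have [s' t' sh' th'|s' [t' [/andP[s0' sh'] /andP[t0' th'] E']]] :=
  @second_difference f a v u _ h0.
  by have [] := PP t' s' th' sh'; rewrite addrAC.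
(* Both values are the same second difference divided twice by [d / 2]. *)
have DD : D1 (a + s *: u + t *: v) = D2 (a + t' *: u + s' *: v).
  have hn : d / 2 != 0 by rewrite gt_eqF.
  apply: (mulfI hn); apply: (mulfI hn).
  rewrite -E (addrAC a (t' *: u)) -E' (addrAC a (_ *: v)).
  by rewrite !opprB addrACA [RHS]addrACA [in RHS](addrC (- _)).
have [_ C1 _] := PP s t ltac:(by rewrite !ltW) ltac:(by rewrite !ltW).
have [_ _ C2] := PP t' s' ltac:(by rewrite !ltW) ltac:(by rewrite !ltW).
suff L : `|D1 a - D2 a| <= `|D1 a - D1 (a + s *: u + t *: v)| +
    `|D2 a - D2 (a + t' *: u + s' *: v)|.
  by have := le_lt_trans L (ltrD C1 C2); rewrite -splitr ltxx.
by rewrite DD (distrC (D2 a)) (le_trans _ (ler_normD _ _)) // addrA subrK.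
Unshelve. all: by end_near. Qed.

(** The coordinate functionals are linear and continuous, hence commute with differentials and
    reduce the claim to scalar functions. *)
Lemma schwarz {W : normedModType R} {fW : findim W} (f : V -> W) (a u v : V) :
  sm f a -> 'd (fun x => 'd f x u) a v = 'd (fun x => 'd f x v) a u.
Proof.
have [I [e [l [cl el]]]] := fW => sf.
have slf i : sm (fun x => l i (f x) : R^o) a.
  by apply: sm_lin_comp => //; exact: linearP.
have dl i (g : V -> W) b w : sm g b -> 'd (fun x => l i (g x)) b w = l i ('d g b w).
  move=> sg; have dlg : differentiable (l i) (g b) by exact: linear_differentiable.
  have H := diff_comp (sm_differentiable sg) dlg.
  have E := congr1 (fun h : V -> R^o => h w) H.
  by rewrite [LHS]E /= (diff_lin _ (cl i)).
rewrite [LHS]el [RHS]el; apply: eq_bigr => i _; congr (_ *: _).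
rewrite -!dl; [|exact: sm_diff|exact: sm_diff].
have E w w' : 'd (fun x => l i ('d f x w)) a w' =
    'd (fun x => 'd (fun y => l i (f y)) x w) a w'.
  have N : \forall x \near a, 'd (fun y => l i (f y)) x w = l i ('d f x w).
    by apply: filterS (sm_near sf) => x; exact: dl.
  have /(diff_near N)[_ ->] // : differentiable
    (fun x => 'd (fun y => l i (f y)) x w : R^o) a.
  exact/sm_differentiable/sm_diff.
by rewrite !E; exact: schwarz_scalar.
Qed.

End Schwarz.

(** * Smooth maps between manifolds *)

(* [is_manifold] without Hausdorffness and second countability. *)
Class atlas_ok (R : realType) (V : normedModType R) (T : charted V) : Prop :=
  AtlasOk {
    dom_refl : forall p : T, dom p p;
    paramK : forall p x : T, dom p x -> param p (chart p x) = x;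
    transition : forall p q : T, open (chart p @` (dom p `&` dom q)) /\
      Cinfty (chart p @` (dom p `&` dom q)) (chart q \o param p) }.

Lemma is_manifold_ok (R : realType) (V : normedModType R) (T : charted V) :
  is_manifold T -> atlas_ok T.
Proof. by case=> h1 h2 h3 _ _; split. Qed.

(** Reading neighbourhoods in the preferred chart of [p] makes filter reasoning available on a bare
    carrier type. By [mnbhsE] any other chart around the point gives the same filter, and [mopenP]
    recovers [mopen]. *)
Definition mnbhs (R : realType) (V : normedModType R) (T : charted V) (p : T) :
  set_system T := param p a @[a --> chart p p].

#[export] Instance mnbhs_filter (R : realType) (V : normedModType R)
  (T : charted V) (p : T) : ProperFilter (mnbhs p).
Proof. exact: fmap_proper_filter. Qed.

Section Charts.
Context {R : realType} {V : normedModType R} {T : charted V} {okT : atlas_ok T}.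
Implicit Types (p q x : T) (U : set T).

Lemma near_chart p q x : dom p x -> dom q x -> \forall a \near chart p x,
  [/\ dom p (param p a), dom q (param p a) & chart p (param p a) = a].
Proof.
move=> px qx; have [oD _] := transition p q.
have : nbhs (chart p x) (chart p @` (dom p `&` dom q)).
  by apply: open_nbhs_nbhs; split=> //; exists x.
by apply: filterS => _ [y [py qy] <-]; rewrite paramK.
Qed.

Lemma sm_transition p q x : dom p x -> dom q x ->
  sm (fun a => chart q (param p a)) (chart p x).
Proof.
move=> px qx; have [oD CD] := transition p q.
by exists (chart p @` (dom p `&` dom q)); split=> //; exists x.
Qed.

Lemma near_change_chart p q x U : dom p x -> dom q x ->
  (\forall a \near chart p x, U (param p a)) ->
  \forall a \near chart q x, U (param q a).
Proof.
move=> px qx Up.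
have c := sm_continuous (sm_transition qx px).
rewrite /= (paramK qx) in c.
have N : \forall a \near chart q x, U (param p (chart p (param q a))).
  exact: c _ Up.
apply: filterS2 N (near_chart qx px) => a Ua [_ pa _]; by rewrite -(paramK pa).
Qed.

Lemma mnbhsE p x U : dom p x ->
  mnbhs x U <-> \forall a \near chart p x, U (param p a).
Proof.
move=> px; split=> H; first exact: near_change_chart (dom_refl x) px H.
exact: near_change_chart px (dom_refl x) H.
Qed.

Lemma mnbhs_singleton p U : mnbhs p U -> U p.
Proof. by move=> /nbhs_singleton /=; rewrite paramK //; exact: dom_refl. Qed.

Lemma mnbhs_dom p x : dom p x -> mnbhs x (dom p).
Proof.
move=> px; apply/(mnbhsE _ px).
by apply: filterS (near_chart px px) => a [].
Qed.

Lemma mopenP U : mopen U <-> forall p, U p -> mnbhs p U.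
Proof.
split=> [oU p Up|nU q].
  have : nbhs (chart p p) (chart p @` (U `&` dom p)).
    apply: open_nbhs_nbhs; split; first exact: oU.
    by exists p => //; split=> //; exact: dom_refl.
  by apply: filterS => _ [y [Uy py] <-]; rewrite /= paramK.
rewrite openE => _ [x [Ux qx] <-].
have /(mnbhsE _ qx) Uq := nU x Ux.
apply: filterS2 Uq (near_chart qx qx) => a Ua [qa _ ca].
by exists (param q a).
Qed.

Lemma mnbhs_near p U : mnbhs p U -> \forall x \near mnbhs p, mnbhs x U.
Proof.
move=> Up; change (\forall a \near chart p p, mnbhs (param p a) U).
have : \forall a \near chart p p, \forall b \near a, U (param p b).
  exact: near_join Up.
have pp : dom p p by exact: dom_refl.
apply: filterS2 (near_chart pp pp) => a [pa _ ca] Ua.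
by apply/(mnbhsE _ pa); rewrite ca.
Qed.

End Charts.

Section SmoothAt.
Context {R : realType}.

(** The first clause carries the continuity: [chart (f p)] has arbitrary values outside its domain,
    so a smooth chart expression alone would not prevent [f] from leaving that domain at points near
    [p]. *)
Definition smooth_at {V W : normedModType R} {S : charted V} {T : charted W}
    (f : S -> T) (p : S) : Prop :=
  mnbhs p (f @^-1` dom (f p)) /\
  sm (fun a => chart (f p) (f (param p a))) (chart p p).

Section OneMap.
Context {V W : normedModType R} {S : charted V} {T : charted W}.
Context {okS : atlas_ok S} {okT : atlas_ok T} {fV : findim V} {fW : findim W}.
Implicit Types (f g : S -> T) (p : S).

Lemma smooth_at_cvg f p U : smooth_at f p -> mnbhs (f p) U -> mnbhs p (f @^-1` U).
Proof.
move=> [df sf] Uf.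
have c := sm_continuous sf; rewrite /= (paramK (dom_refl p)) in c.
have N : \forall a \near chart p p, U (param (f p) (chart (f p) (f (param p a)))).
  exact: c _ Uf.
by apply: filterS2 df N => a /= da Ua; rewrite -(paramK da); exact: Ua.
Qed.

Lemma smooth_at_chart f p q q' : dom q p -> dom q' (f p) -> smooth_at f p ->
  sm (fun a => chart q' (f (param q a))) (chart q p).
Proof.
move=> qp qf [df sf].
have [pp ff] : dom p p /\ dom (f p) (f p) by split; exact: dom_refl.
apply: (@sm_eq _ _ _ (fun a => chart q' (param (f p) (chart (f p)
  (f (param p (chart p (param q a)))))))).
  have /(mnbhsE _ qp) df' := df.
  apply: filterS2 (near_chart qp pp) df' => a [_ pa _] da.
  by rewrite (paramK pa) paramK.
apply: (sm_comp (g := fun a => chart q' (param (f p) a))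
  (f := fun a => chart (f p) (f (param p (chart p (param q a)))))).
  apply: (sm_comp (g := fun a => chart (f p) (f (param p a)))
    (f := fun a => chart p (param q a))); first exact: sm_transition.
  by rewrite (paramK qp).
by rewrite (paramK qp) (paramK pp); exact: sm_transition.
Qed.

Lemma smooth_at_intro f p q q' : dom q p -> dom q' (f p) ->
  mnbhs p (f @^-1` dom q') ->
  sm (fun a => chart q' (f (param q a))) (chart q p) -> smooth_at f p.
Proof.
move=> qp qf df sf.
have [pp ff] : dom p p /\ dom (f p) (f p) by split; exact: dom_refl.
have /(mnbhsE _ qp) df' := df.
have dff : mnbhs p (f @^-1` dom (f p)).
  apply/(mnbhsE _ qp).
  have c := sm_continuous sf; rewrite /= (paramK qp) in c.
  have N : \forall a \near chart q p,
      dom (f p) (param q' (chart q' (f (param q a)))).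
    by apply: (c (fun b => dom (f p) (param q' b))); apply: filterS (near_chart qf
      ff) => b [].
  by apply: filterS2 df' N => a /= da Ua; rewrite -(paramK da).
split=> //.
apply: (@sm_eq _ _ _ (fun a => chart (f p) (param q' (chart q'
  (f (param q (chart q (param p a)))))))).
  have dfp : \forall a \near chart p p, dom q' (f (param p a)) by exact: df.
  apply: filterS2 dfp (near_chart pp qp) => a da [_ qa _].
  by rewrite (paramK qa) paramK.
apply: (sm_comp (g := fun a => chart (f p) (param q' a))
  (f := fun a => chart q' (f (param q (chart q (param p a)))))).
  apply: (sm_comp (g := fun a => chart q' (f (param q a)))
    (f := fun a => chart q (param p a))); first exact: sm_transition.
  by rewrite (paramK pp).
by rewrite (paramK pp) (paramK qp); exact: sm_transition.
Qed.

Lemma smooth_at_eq f g p : mnbhs p [set x | f x = g x] -> smooth_at f p ->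
  smooth_at g p.
Proof.
move=> fg [df sf]; have e : f p = g p by exact: (mnbhs_singleton fg).
split; first by apply: filterS2 df fg => x; rewrite /= e => dfx <-.
have fga : \forall a \near chart p p, f (param p a) = g (param p a) by exact: fg.
by apply: sm_eq sf; rewrite e; apply: filterS fga => a ->.
Qed.

Lemma smooth_at_near f p : smooth_at f p -> \forall x \near mnbhs p, smooth_at f x.
Proof.
move=> [df sf]; have pp : dom p p by exact: dom_refl.
have ndf := mnbhs_near df.
have nsf : \forall x \near mnbhs p,
    sm (fun a => chart (f p) (f (param p a))) (chart p x) .
  change (\forall a \near chart p p,
    sm (fun a => chart (f p) (f (param p a))) (chart p (param p a))).
  by apply: filterS2 (near_chart pp pp) (sm_near sf) => a [_ _ ca]; rewrite ca.
near=> x; apply: (@smooth_at_intro f x p (f p)).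
- by near: x; exact: mnbhs_dom.
- by near: x; exact: df.
- by near: x; exact: ndf.
- by near: x; exact: nsf.
Unshelve. all: by end_near. Qed.

(** On an open set the local extension in [smooth_on] agrees with [f] on a neighbourhood of [p], so
    both have the same germ. *)
Lemma smooth_on_at (A : set S) f p : mopen A -> smooth_on A f -> A p ->
  smooth_at f p.
Proof.
move=> oA sf Ap; have [B [g [mO Op Od Cg gf]]] := sf p Ap.
have nA : mnbhs p A by exact: ((mopenP A).1 oA).
have nO : mnbhs p B by exact: ((mopenP B).1 mO).
have gp : g p = f p by exact: gf.
apply: (@smooth_at_eq g).
  by apply: filterS2 nA nO => x; exact: gf.
split.
  by apply: (filterS _ nO) => x Bx; rewrite /= gp; exact: (Od x Bx).2.
exists (chart p @` B); rewrite gp; split; [|by exists p|exact: Cg].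
suff E : B `&` dom p = B by have := mO p; rewrite E.
by apply/setIidPl => x Bx; exact: (Od x Bx).1.
Qed.

(** Here [f] is its own extension, once the open set is shrunk to a part of the chart where
    [param p] and [chart p] are inverse to each other and [f] stays in one chart domain. *)
Lemma smooth_at_on (A : set S) f : (forall p, A p -> smooth_at f p) ->
  smooth_on A f.
Proof.
move=> sf p Ap; have [df [B [oB Bp CB]]] := sf p Ap.
have pp : dom p p by exact: dom_refl.
have : \forall a \near chart p p, [/\ dom p (param p a),
    dom (f p) (f (param p a)), chart p (param p a) = a & B a].
  have nB : nbhs (chart p p) B by exact: open_nbhs_nbhs.
  have dfp : \forall a \near chart p p, dom (f p) (f (param p a)) by exact: df.
  by apply: filterS3 dfp nB (near_chart pp pp) => a ? ? [].
move=> H; move: (H : nbhs _ _); rewrite nbhsE => -[D [oD Dp] Dh].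
exists (param p @` D), f; split=> //.
- apply/mopenP => _ [a Da <-].
  have [da _ ca _] := Dh _ Da; apply/(mnbhsE _ da); rewrite ca.
  by apply: filterS (open_nbhs_nbhs (conj oD Da)) => b Db; exists b.
- by exists (chart p p) => //; rewrite paramK.
- by move=> _ [a /Dh[] ? ? ? ? <-].
- move=> k; apply: Ck_sub (CB k) => _ [_ [a Da <-] <-].
  by have [_ _ -> Ba] := Dh _ Da.
Qed.

End OneMap.
End SmoothAt.

Section Local.
Context {R : realType}.
Implicit Types V W : normedModType R.

Lemma diff_eq_near V W (f g : V -> W) a u :
  (\forall x \near a, f x = g x) -> sm f a -> 'd g a u = 'd f a u.
Proof.
move=> fg sf.
exact: (congr1 (fun h : V -> W => h u) (diff_near fg (sm_differentiable sf)).2).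
Qed.

(* Same as [filterS] and [filterS2]; stating them for a normed module makes them
   applicable to the model spaces of [mprod], whose filters are not inferred. *)
Lemma nearS V (a : V) (P Q : set V) : (forall x, P x -> Q x) ->
  (\forall x \near a, P x) -> \forall x \near a, Q x.
Proof. exact: filterS. Qed.

Lemma nearS2 V (a : V) (P Q P' : set V) : (forall x, P x -> Q x -> P' x) ->
  (\forall x \near a, P x) -> (\forall x \near a, Q x) -> \forall x \near a, P' x.
Proof. exact: filterS2. Qed.

Lemma Cinfty_local V W (A : set V) (f : V -> W) :
  (forall a, A a -> sm f a) -> Cinfty A f.
Proof.
move=> sf k; elim: k f sf => [|k IH] f sf.
  by move=> a /sf /sm_continuous.
split=> [a /sf /sm_differentiable //|u].
by apply: IH => a /sf; exact: sm_diff.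
Qed.

Lemma atlas_ok_intro V (T : charted V) :
  (forall p : T, dom p p) ->
  (forall p x : T, dom p x -> param p (chart p x) = x) ->
  (forall p q x : T, dom p x -> dom q x ->
     (\forall a \near chart p x,
       [/\ dom p (param p a), dom q (param p a) & chart p (param p a) = a]) /\
     sm (fun a => chart q (param p a)) (chart p x)) ->
  atlas_ok T.
Proof.
move=> h1 h2 h3; split=> // p q; split.
  rewrite openE => _ [x [px qx] <-]; have [N _] := h3 p q x px qx.
  by apply: filterS N => a [pa qa ca]; exists (param p a).
by apply: Cinfty_local => _ [x [px qx] <-]; exact: (h3 p q x px qx).2.
Qed.

#[export] Instance model_ok V : atlas_ok (model V).
Proof.
apply: atlas_ok_intro => // p q x _ _; split; last exact: sm_id.
by apply: nearW => a; split.
Qed.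

Lemma smooth_at_model V W (f : model V -> model W) a :
  sm f a -> smooth_at f a.
Proof. by move=> sf; split=> //; exact: nearW. Qed.

End Local.

Section Comp.
Context {R : realType} {U V W : normedModType R}.
Context {S : charted U} {T : charted V} {Q : charted W}.
Context {okS : atlas_ok S} {okT : atlas_ok T} {okQ : atlas_ok Q}.
Context {fU : findim U} {fV : findim V} {fW : findim W}.

(** Composing the two chart expressions inserts [param (f p)] after [chart (f p)]; the pair cancels
    only while [f] stays in the domain, so the equality holds just near the point. *)
Lemma comp_chart_near (f : S -> T) (g : T -> Q) (p : S) :
  smooth_at f p -> smooth_at g (f p) ->
  sm (fun a => chart (g (f p)) (g (param (f p) (chart (f p) (f (param p a))))))
    (chart p p) /\
  \forall a \near chart p p,
    chart (g (f p)) (g (param (f p) (chart (f p) (f (param p a))))) =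
    chart (g (f p)) (g (f (param p a))).
Proof.
move=> [df sf] [dg sg]; split.
  apply: (sm_comp (g := fun b => chart (g (f p)) (g (param (f p) b)))
    (f := fun a => chart (f p) (f (param p a)))) sf _.
  by rewrite (paramK (dom_refl p)).
have df' : \forall a \near chart p p, dom (f p) (f (param p a)) by exact: df.
by apply: (filterS _ df') => a /paramK ->.
Qed.

Lemma smooth_at_comp (f : S -> T) (g : T -> Q) (p : S) :
  smooth_at f p -> smooth_at g (f p) -> smooth_at (fun x => g (f x)) p.
Proof.
move=> sf sg; have [sc E] := comp_chart_near sf sg.
by split; [exact: (smooth_at_cvg sf sg.1)|exact: sm_eq E sc].
Qed.

Lemma dmap_comp (f : S -> T) (g : T -> Q) (p : S) u :
  smooth_at f p -> smooth_at g (f p) ->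
  dmap (fun x => g (f x)) p u = dmap g (f p) (dmap f p u).
Proof.
move=> sf sg; have [sc E] := comp_chart_near sf sg.
rewrite /dmap; transitivity ('d (fun a => chart (g (f p))
  (g (param (f p) (chart (f p) (f (param p a)))))) (chart p p) u).
  exact: diff_eq_near E sc.
have e : chart (f p) (f (param p (chart p p))) = chart (f p) (f p).
  by rewrite (paramK (dom_refl p)).
have := @sm_comp_diff R U V W _ _ (fun a => chart (f p) (f (param p a)))
  (fun b => chart (g (f p)) (g (param (f p) b))) (chart p p) u sf.2.
by rewrite e; apply; exact: sg.2.
Qed.

Lemma dmap_eq (f g : S -> T) (p : S) u :
  mnbhs p [set x | f x = g x] -> smooth_at f p -> dmap g p u = dmap f p u.
Proof.
move=> fg [df sf]; have e : f p = g p by exact: (mnbhs_singleton fg).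
have fga : \forall a \near chart p p,
    chart (f p) (f (param p a)) = chart (f p) (g (param p a)).
  have E : \forall a \near chart p p, f (param p a) = g (param p a) by exact: fg.
  by apply: (filterS _ E) => a ->.
by have := diff_eq_near u fga sf; rewrite /dmap -e.
Qed.

Lemma dmap0 (f : S -> T) (p : S) : dmap f p 0 = 0.
Proof. by rewrite /dmap linear0. Qed.

Lemma smooth_at_cst (y : T) (p : S) : smooth_at (fun=> y) p.
Proof.
split; last exact: sm_cst.
by apply: nearW => a; exact: dom_refl.
Qed.

Lemma dmap_cst (y : T) (p : S) u : dmap (fun=> y) p u = 0.
Proof.
have := diff_cst (chart y y) (chart p p).
by move=> H; exact: (congr1 (fun h : U -> V => h u) H).
Qed.

End Comp.

Section ChartMaps.
Context {R : realType} {V : normedModType R} {T : charted V}.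
Context {okT : atlas_ok T} {fV : findim V}.

Lemma smooth_at_param (z x : T) : dom z x ->
  smooth_at (param z : model V -> T) (chart z x).
Proof.
move=> zx.
apply: (@smooth_at_intro _ _ _ (model V) T _ _ _ _ _ (chart z x) (chart z x) z) => //.
- by rewrite paramK.
- have N : \forall a \near chart z x, dom z (param z a).
    by apply: filterS (near_chart zx zx) => a [].
  exact: N.
- apply: (@sm_eq _ _ _ id); last exact: sm_id.
  by apply: (filterS _ (near_chart zx zx)) => a [_ _ ca]; rewrite -[LHS]ca.
Qed.

Lemma smooth_at_chart_map (z x : T) : dom z x ->
  smooth_at (chart z : T -> model V) x.
Proof.
move=> zx.
apply: (@smooth_at_intro _ _ _ T (model V) _ _ _ _ _ x z (chart z x)) => //.
- exact: nearW.
- apply: (@sm_eq _ _ _ id); last exact: sm_id.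
  by apply: (filterS _ (near_chart zx zx)) => a [_ _ ca]; rewrite -[LHS]ca.
Qed.

End ChartMaps.

(** * Products, powers and the cotangent bundle as manifolds *)

Section Products.
Context {R : realType} {V W : normedModType R} {S : charted V} {T : charted W}.
Context {okS : atlas_ok S} {okT : atlas_ok T} {fV : findim V} {fW : findim W}.

Lemma near_fst (a : ((V * W)%type : normedModType R)) (P : set V) :
  (\forall x \near a.1, P x) -> \forall p \near a, P p.1.
Proof. by case: a => a b; exact: (@fst_continuous _ _ _ (a, b)). Qed.

Lemma near_snd (a : ((V * W)%type : normedModType R)) (P : set W) :
  (\forall x \near a.2, P x) -> \forall p \near a, P p.2.
Proof. by case: a => a b; exact: (@snd_continuous _ _ _ (a, b)). Qed.

#[export] Instance mprod_ok : atlas_ok (mprod S T).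
Proof.
apply: atlas_ok_intro.
- by move=> p; split; exact: dom_refl.
- by move=> p x [h1 h2]; apply: injective_projections; rewrite /= paramK.
- move=> p q x [p1 p2] [q1 q2]; split.
    pose proof (@near_fst (chart p x) _ (near_chart p1 q1)) as N1.
    pose proof (@near_snd (chart p x) _ (near_chart p2 q2)) as N2.
    apply: (nearS2 _ N1 N2) => a [a1 a2 a3] [b1 b2 b3]; split.
    + by split.
    + by split.
    + by apply: injective_projections.
  apply: (sm_pair (f := fun a => chart q.1 (param p.1 a.1))
    (g := fun a => chart q.2 (param p.2 a.2))).
    apply: (sm_comp (f := fst) (g := fun a => chart q.1 (param p.1 a))).
      exact: sm_fst.
    exact: sm_transition.
  apply: (sm_comp (f := snd) (g := fun a => chart q.2 (param p.2 a))).
    exact: sm_snd.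
  exact: sm_transition.
Qed.

Lemma smooth_at_fst (p : mprod S T) : smooth_at (fst : mprod S T -> S) p.
Proof.
split.
  pose proof (@near_fst (chart p p) _
    (near_chart (dom_refl p.1) (dom_refl p.1))) as N.
  by apply: (nearS _ N) => a [].
pose proof (@near_fst (chart p p) _
  (near_chart (dom_refl p.1) (dom_refl p.1))) as N.
apply: (@sm_eq _ _ _ fst); last exact: sm_fst.
by apply: (nearS _ N) => a [_ _ E]; rewrite -[LHS]E.
Qed.

Lemma smooth_at_snd (p : mprod S T) : smooth_at (snd : mprod S T -> T) p.
Proof.
pose proof (@near_snd (chart p p) _
  (near_chart (dom_refl p.2) (dom_refl p.2))) as N.
split; first by apply: (nearS _ N) => a [].
apply: (@sm_eq _ _ _ snd); last exact: sm_snd.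
by apply: (nearS _ N) => a [_ _ E]; rewrite -[LHS]E.
Qed.

Lemma smooth_at_pair {U : normedModType R} {Q : charted U} {okQ : atlas_ok Q}
    {fU : findim U} (f : Q -> S) (g : Q -> T) (p : Q) :
  smooth_at f p -> smooth_at g p ->
  smooth_at (fun x => (f x, g x) : mprod S T) p.
Proof.
move=> [df sf] [dg sg]; split; last exact: sm_pair sf sg.
by apply: filterS2 df dg => x h1 h2; split.
Qed.

Lemma dmap_pair {U : normedModType R} {Q : charted U} {okQ : atlas_ok Q}
    {fU : findim U} (f : Q -> S) (g : Q -> T) (p : Q) u :
  smooth_at f p -> smooth_at g p ->
  dmap (fun x => (f x, g x) : mprod S T) p u = (dmap f p u, dmap g p u).
Proof.
move=> [df sf] [dg sg].
have H := diff_pair (sm_differentiable sf) (sm_differentiable sg).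
exact: (congr1 (fun h : U -> V * W => h u) H).
Qed.

End Products.

Section Powers.
Context {R : realType} {d k : nat} {M : charted 'rV[R]_d} {okM : atlas_ok M}.

Lemma sm_row i (A : 'M[R]_(k, d)) : sm (row i) A.
Proof.
apply: sm_mx => i' j; apply: (sm_congr (f := fun B : 'M[R]_(k, d) => B i j : R^o)).
  by move=> B; rewrite mxE.
exact: sm_coord.
Qed.

Lemma sm_rows {V : normedModType R} (F : 'I_k -> V -> 'rV[R]_d) a :
  (forall i, sm (F i) a) -> sm (fun x => \matrix_i F i x) a.
Proof.
move=> sF; apply: sm_mx => i j.
apply: (sm_congr (f := fun x => F i x ord0 j : R^o)); first by move=> x; rewrite mxE.
exact: sm_mxcoord.
Qed.

Lemma near_rows (A : 'M[R]_(k, d)) (P : 'I_k -> set 'rV[R]_d) :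
  (forall i, \forall x \near row i A, P i x) ->
  \forall B \near A, forall i, P i (row i B).
Proof.
move=> H; apply: (@filter_forall _ _ (fun i (B : 'M[R]_(k, d)) => P i (row i B))
  (nbhs A) (nbhs_filter A)) => i.
exact: (@sm_continuous _ _ _ _ _ (sm_row i A) _ (H i)).
Qed.

Lemma near_rows_chart (p x : mpow k M) (P : 'I_k -> set 'rV[R]_d) :
  (forall i, \forall y \near chart (p i) (x i), P i y) ->
  \forall B \near chart p x, forall i, P i (row i B).
Proof.
move=> H; apply: (@near_rows (\matrix_i chart (p i) (x i))) => i; rewrite rowK.
exact: H.
Qed.

#[export] Instance mpow_ok : atlas_ok (mpow k M).
Proof.
apply: atlas_ok_intro.
- by move=> p i; exact: dom_refl.
- move=> p x px; apply/funext => i /=.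
  by rewrite /param /chart /= rowK; exact: paramK.
- move=> p q x px qx; split.
    pose proof (near_rows_chart (fun i => near_chart (px i) (qx i))) as N.
    apply: (filterS _ N) => A H; split.
    + by move=> i; have [] := H i.
    + by move=> i; have [] := H i.
    + by apply/row_matrixP => i; rewrite rowK; have [] := H i.
  apply: (sm_rows (F := fun i A => chart (q i) (param (p i) (row i A)))) => i.
  apply: (sm_comp (f := row i) (g := fun a => chart (q i) (param (p i) a))).
    exact: sm_row.
  by rewrite rowK; exact: sm_transition.
Qed.

Lemma smooth_at_comp_pow {U : normedModType R} {Q : charted U} {okQ : atlas_ok Q}
    {fU : findim U} (f : Q -> mpow k M) (p : Q) :
  (forall i, smooth_at (fun x => f x i) p) -> smooth_at f p.
Proof.
move=> sf; split; last first.
  by apply: (sm_rows (F := fun i a => chart (f p i) (f (param p a) i))) => i;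
    exact: (sf i).2.
have N : \forall a \near chart p p, forall i, dom (f p i) (f (param p a) i).
  apply: (@filter_forall _ _ (fun i a => dom (f p i) (f (param p a) i))
    (nbhs (chart p p)) (nbhs_filter _)) => i.
  exact: (sf i).1.
exact: N.
Qed.

Lemma smooth_at_ith i (p : mpow k M) : smooth_at (fun x : mpow k M => x i) p.
Proof.
pose proof (near_rows_chart (fun i => near_chart (dom_refl (p i)) (dom_refl (p i)))) as N.
split; first by apply: (filterS _ N) => A H; have [] := H i.
apply: (@sm_eq _ _ _ (row i)); last exact: sm_row.
by apply: (filterS _ N) => A H; have [_ _ E] := H i; rewrite -[LHS]E.
Qed.

End Powers.

Section Cotangent.
Context {R : realType} {d : nat} {M : charted 'rV[R]_d} {okM : atlas_ok M}.
Implicit Types (p q x : M).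

Lemma mulmx_rV_inj m n (A B : 'M[R]_(m, n)) :
  (forall u : 'rV_m, u *m A = u *m B) -> A = B.
Proof. by move=> AB; apply/row_matrixP => i; rewrite !rowE. Qed.

Lemma mul_jacobian m n (f : 'rV[R]_m -> 'rV[R]_n) a u : u *m 'J f a = 'd f a u.
Proof. by rewrite /jacobian mul_rV_lin1. Qed.

(** The chain rule on a triple overlap. On row vectors Jacobians multiply in the order of
    composition, and transposition reverses this, as the fibre coordinates of covectors require. *)
Lemma jacobian_transition p q r x : dom p x -> dom q x -> dom r x ->
  'J (chart q \o param p) (chart p x) *m 'J (chart r \o param q) (chart q x) =
  'J (chart r \o param p) (chart p x).
Proof.
move=> px qx rx; apply: mulmx_rV_inj => u.
rewrite mulmxA.
apply: (etrans (congr1 (mulmxr _) (mul_jacobian _ _ u))).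
apply: (etrans (mul_jacobian _ _ _)); apply: (etrans _ (esym (mul_jacobian _ _ u))).
pose proof (sm_transition px qx) as s1; pose proof (sm_transition qx rx) as s2.
have E : chart q (param p (chart p x)) = chart q x by rewrite paramK.
pose proof (@sm_comp_diff R 'rV[R]_d 'rV[R]_d 'rV[R]_d _ _
  (fun a => chart q (param p a)) (fun a => chart r (param q a)) (chart p x) u s1) as H.
rewrite E in H; apply: (etrans (esym (H s2))).
apply: diff_eq_near; last exact: sm_transition.
apply: (nearS _ (near_chart px qx)) => a [_ qa _].
by rewrite /= (paramK qa).
Qed.

Lemma jacobian_refl p x : dom p x -> 'J (chart p \o param p) (chart p x) = 1%:M.
Proof.
move=> px; apply: mulmx_rV_inj => u; rewrite mulmx1; apply: (etrans (mul_jacobian _ _ u)).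
have N : \forall a \near chart p x, id a = (chart p \o param p) a.
  by apply: (nearS _ (near_chart px px)) => a [_ _ E]; rewrite -[LHS]E.
rewrite (diff_eq_near u N); last exact: sm_id.
have dI : is_diff (chart p x) id id by exact: is_diff_id.
have H := @diff_val _ _ _ _ _ _ _ dI.
exact: (congr1 (fun h : 'rV[R]_d -> 'rV[R]_d => h u) H).
Qed.

Lemma sm_jacobian (F : 'rV[R]_d -> 'rV[R]_d) a : sm F a -> sm (fun b => 'J F b) a.
Proof.
move=> sF; apply: sm_mx => i j.
apply: (sm_congr (f := fun b => 'd F b (delta_mx 0 i) 0 j : R^o)).
  by move=> b; rewrite /jacobian mxE.
exact/sm_mxcoord/sm_diff.
Qed.

Lemma sm_trmx (V : normedModType R) m n (F : V -> 'M[R]_(m, n)) a :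
  sm F a -> sm (fun b => (F b)^T) a.
Proof.
move=> sF; apply: sm_mx => i j; apply: (sm_congr (f := fun b => F b j i : R^o)).
  by move=> b; rewrite mxE.
exact: sm_mxcoord.
Qed.

Lemma sm_lsubmx m n (A : 'rV[R]_(m + n)) : sm (lsubmx : 'rV[R]_(m + n) -> 'rV[R]_m) A.
Proof.
apply: sm_mx => i j.
apply: (sm_congr (f := fun B : 'rV[R]_(m + n) => B i (lshift n j) : R^o)).
  by move=> B; rewrite mxE.
exact: sm_coord.
Qed.

Lemma sm_rsubmx m n (A : 'rV[R]_(m + n)) : sm (rsubmx : 'rV[R]_(m + n) -> 'rV[R]_n) A.
Proof.
apply: sm_mx => i j.
apply: (sm_congr (f := fun B : 'rV[R]_(m + n) => B i (rshift m j) : R^o)).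
  by move=> B; rewrite mxE.
exact: sm_coord.
Qed.

Lemma sm_row_mx (V : normedModType R) m n (F : V -> 'rV[R]_m) (G : V -> 'rV[R]_n) a :
  sm F a -> sm G a -> sm (fun b => row_mx (F b) (G b)) a.
Proof.
move=> sF sG; apply: sm_mx => i j; case: (split_ordP j) => k ->.
  apply: (sm_congr (f := fun b => F b i k : R^o)).
    by move=> b; rewrite /= row_mxEl.
  exact: sm_mxcoord.
apply: (sm_congr (f := fun b => G b i k : R^o)).
  by move=> b; rewrite /= row_mxEr.
exact: sm_mxcoord.
Qed.

Lemma near_cotangent_chart (p : cotangent M) (x : cotangent M) (P : set 'rV[R]_d) :
  (\forall b \near chart p.1 x.1, P b) -> \forall a \near chart p x, P (lsubmx a).
Proof.
move=> H; apply: (@sm_continuous _ _ _ _ _ (sm_lsubmx (chart p x)) _ _).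
by rewrite row_mxKl.
Qed.

#[export] Instance cotangent_ok : atlas_ok (cotangent M).
Proof.
apply: atlas_ok_intro.
- by move=> p; exact: (dom_refl (p.1 : M)).
- move=> p [x xi] px; change (dom p.1 x) in px.
  change ((param p.1 (lsubmx (chart p ((x, xi) : cotangent M))),
    rsubmx (chart p ((x, xi) : cotangent M)) *m
    ('J (chart p.1 \o param (param p.1 (lsubmx (chart p ((x, xi) : cotangent M)))))
      (chart (param p.1 (lsubmx (chart p ((x, xi) : cotangent M))))
       (param p.1 (lsubmx (chart p ((x, xi) : cotangent M))))))^T) = (x, xi)).
  rewrite row_mxKl row_mxKr (paramK px); congr pair.
  rewrite -mulmxA -trmx_mul.
  have xx : dom x x by exact: dom_refl.
  by rewrite (jacobian_transition xx px xx) (jacobian_refl xx) trmx1 mulmx1.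
- move=> p q x px qx; change (dom p.1 x.1) in px; change (dom q.1 x.1) in qx.
  pose proof (@near_cotangent_chart p x _ (near_chart px qx)) as N.
  (* Fibre coordinates pass through the preferred chart of the base point, which varies with [a]
     without any continuity. The cocycle identity removes this intermediate chart, after which the
     transition map is visibly smooth. *)
  have jE (r : M) a : dom p.1 (param p.1 (lsubmx a)) -> dom r (param p.1 (lsubmx a)) ->
      chart p.1 (param p.1 (lsubmx a)) = lsubmx a ->
      rsubmx a *m ('J (chart p.1 \o param (param p.1 (lsubmx a)))
        (chart (param p.1 (lsubmx a)) (param p.1 (lsubmx a))))^T *m
        ('J (chart (param p.1 (lsubmx a)) \o param r) (chart r (param p.1 (lsubmx a))))^T
      = rsubmx a *m ('J (chart p.1 \o param r) (chart r (param p.1 (lsubmx a))))^T.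
    move=> pa ra ca; rewrite -mulmxA -trmx_mul; congr (_ *m _^T).
    by apply: jacobian_transition => //; exact: dom_refl.
  split.
    apply: (nearS _ N) => a [pa qa ca]; split=> //.
    rewrite /chart /param /= -/(param _ _) -/(chart _ _) (jE p.1) // ca.
    by rewrite -{2}ca (jacobian_refl pa) trmx1 mulmx1 hsubmxK.
  apply: (@sm_eq _ _ _ (fun a => row_mx (chart q.1 (param p.1 (lsubmx a)))
    (rsubmx a *m ('J (chart p.1 \o param q.1) (chart q.1 (param p.1 (lsubmx a))))^T))).
    apply: (nearS _ N) => a [pa qa ca].
    by rewrite /chart /param /= -/(param _ _) -/(chart _ _) (jE q.1).
  have st : sm (fun a : 'rV[R]_(d + d) => chart q.1 (param p.1 (lsubmx a))) (chart p x).
    apply: (sm_comp (f := lsubmx) (g := fun a => chart q.1 (param p.1 a))).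
      exact: sm_lsubmx.
    by rewrite row_mxKl; exact: sm_transition.
  apply: (sm_row_mx st); apply: sm_mulmx; first exact: sm_rsubmx.
  apply: sm_trmx; apply: (sm_comp (g := fun b => 'J (chart p.1 \o param q.1) b) st).
  rewrite row_mxKl (paramK px); apply: sm_jacobian; exact: sm_transition.
Qed.

Lemma smooth_at_base (a : cotangent M) : smooth_at (fst : cotangent M -> M) a.
Proof.
have aa : dom a.1 a.1 by exact: dom_refl.
pose proof (@near_cotangent_chart a a _ (near_chart aa aa)) as N.
split; first by apply: (nearS _ N) => b [].
apply: (@sm_eq _ _ _ lsubmx); last exact: sm_lsubmx.
by apply: (nearS _ N) => b [_ _ E]; rewrite -[LHS]E.
Qed.

End Cotangent.

(** * Differential forms along maps *)

Section DiffRules.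
Context {R : realType}.
Implicit Types U V W : normedModType R.

Lemma diff_linear V W (f : V -> W) a u : linear f -> continuous f -> 'd f a u = f u.
Proof.
move=> lf cf.
exact: (congr1 (fun h : V -> W => h u) (@diff_lin _ _ _ (pack_linear lf) a cf)).
Qed.

Lemma diff_fst V W (a u : V * W) : 'd (fst : V * W -> V) a u = u.1.
Proof. by apply: diff_linear; [exact: fst_linear|exact: fst_continuous]. Qed.

Lemma diff_snd V W (a u : V * W) : 'd (snd : V * W -> W) a u = u.2.
Proof. by apply: diff_linear; [exact: snd_linear|exact: snd_continuous]. Qed.

Lemma diff_sm_add V W (f g : V -> W) a u : sm f a -> sm g a ->
  'd (fun x => f x + g x) a u = 'd f a u + 'd g a u.
Proof.
move=> sf sg; have H := diffD (sm_differentiable sf) (sm_differentiable sg).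
exact: (congr1 (fun h : V -> W => h u) H).
Qed.

Lemma diff_sm_sub V W (f g : V -> W) a u : sm f a -> sm g a ->
  'd (fun x => f x - g x) a u = 'd f a u - 'd g a u.
Proof.
move=> sf sg; have H := diffB (sm_differentiable sf) (sm_differentiable sg).
exact: (congr1 (fun h : V -> W => h u) H).
Qed.

Lemma diff_sm_mul V (f g : V -> R^o) a u : sm f a -> sm g a ->
  'd (fun x => f x * g x : R^o) a u = f a * 'd g a u + g a * 'd f a u.
Proof.
move=> sf sg; have H := diffM (sm_differentiable sf) (sm_differentiable sg).
exact: (congr1 (fun h : V -> R^o => h u) H).
Qed.

Lemma diff_sm_cst V W (c : W) (a u : V) : 'd (fun=> c) a u = 0.
Proof. exact: (congr1 (fun h : V -> W => h u) (diff_cst c a)). Qed.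

Lemma diff_sm_sum V W (I : Type) (r : seq I) (f : I -> V -> W) a u :
  (forall i, sm (f i) a) ->
  'd (fun x => \sum_(i <- r) f i x) a u = \sum_(i <- r) 'd (f i) a u.
Proof.
move=> sf; elim: r => [|i r IH].
  rewrite big_nil -[RHS](diff_sm_cst (0 : W) a u).
  by congr ('d _ _ _); apply/funext => x; rewrite big_nil.
rewrite big_cons -IH -(diff_sm_add u (sf i) (sm_sum r sf)).
by congr ('d _ _ _); apply/funext => x; rewrite big_cons.
Qed.

Lemma diff_sm_pair U V W (f : U -> V) (g : U -> W) a u : sm f a -> sm g a ->
  'd (fun x => (f x, g x)) a u = ('d f a u, 'd g a u).
Proof.
move=> sf sg; have H := diff_pair (sm_differentiable sf) (sm_differentiable sg).
exact: (congr1 (fun h : U -> V * W => h u) H).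
Qed.

(** Linearity in the second slot turns the pairing into a finite sum of products, so smoothness of
    [G] in its first slot is needed only for fixed vectors. *)
Lemma diff_pairing U V {fU : findim U} {fV : findim V} (G : V -> V -> R^o) (g h : U -> V)
    (v0 e : U) :
  (forall a, linear (G a)) -> (forall w, sm (G^~ w) (g v0)) ->
  sm g v0 -> sm h v0 ->
  sm (fun v => G (g v) (h v)) v0 /\
  'd (fun v => G (g v) (h v)) v0 e =
    'd (G^~ (h v0)) (g v0) ('d g v0 e) + G (g v0) ('d h v0 e).
Proof.
have [I [b [l [cl el]]]] := fV; move=> lG sG sg sh.
have GE a w : G a w = \sum_i (l i w * G a (b i) : R^o).
  rewrite {1}(el w) -[LHS]/(pack_linear (lG a) _) linear_sum.
  by apply: eq_bigr => i _; rewrite linearZ.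
have sl i : sm (fun v => l i (h v) : R^o) v0.
  by apply: sm_lin_comp; [exact: linearP|exact: cl|].
have sGb i : sm (fun v => G (g v) (b i)) v0.
  exact: (sm_comp (f := g) (g := G^~ (b i))).
have E : (fun v => G (g v) (h v)) = (fun v => \sum_i (l i (h v) * G (g v) (b i) : R^o)).
  by apply/funext => v; exact: GE.
have E' : G^~ (h v0) = (fun a => \sum_i (l i (h v0) * G a (b i) : R^o)).
  by apply/funext => v; exact: GE.
rewrite E; split.
  by apply: (@sm_sum _ _ _ _ (index_enum I)) => i; exact: sm_mul.
rewrite diff_sm_sum; last by move=> i; exact: sm_mul.
rewrite E' diff_sm_sum; last by move=> i; apply: sm_mul => //; exact: sm_cst.
rewrite [X in _ + X]GE -big_split /=; apply: eq_bigr => i _.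
rewrite diff_sm_mul // diff_sm_mul //; last exact: sm_cst.
rewrite diff_sm_cst mulr0 addr0; congr (_ + _).
  congr (_ * _); exact: (@sm_comp_diff _ _ _ _ _ _ g (G^~ (b i))).
rewrite mulrC; congr (_ * _).
rewrite (@sm_comp_diff _ _ _ _ _ _ h (l i)) //.
  by apply: diff_linear; [exact: linearP|exact: cl].
by apply: sm_lin; [exact: linearP|exact: cl].
Qed.

End DiffRules.

Section Along.
Context {R : realType} {U V : normedModType R} {T : charted V}.
Context {okT : atlas_ok T} {fU : findim U} {fV : findim V}.
Context (phi : form1 T) (sphi : smooth_form1 phi).

Lemma smooth_at_model_chart (Z : model U -> T) (v : U) z : smooth_at Z v ->
  dom z (Z v) -> sm (fun w => chart z (Z w)) v.
Proof. by move=> sZ zv; exact: (smooth_at_chart (S := model U) (q := v) _ zv sZ). Qed.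

(** On the right the velocity is written in the preferred chart of [Z v], which jumps with [v]; on
    the left the same number is written in a chart [z] that can be kept fixed, and can be
    differentiated in [v]. *)
Lemma local1_along (Z : model U -> T) (v u : U) z : smooth_at Z v -> dom z (Z v) ->
  local1 z phi (chart z (Z v)) ('d (fun w => chart z (Z w)) v u) =
  phi (Z v) (dmap Z v u).
Proof.
move=> sZ zv.
have sg : smooth_at (fun w : model U => chart z (Z w) : model V) v.
  apply: (smooth_at_comp (T := T) sZ); exact: smooth_at_chart_map.
pose proof (dmap_comp (S := model U) (T := model V) (Q := T)
  (f := fun w => chart z (Z w)) (g := param z) u sg (smooth_at_param zv)) as H.
have e : mnbhs (v : model U) [set w | Z w = param z (chart z (Z w))].
  by apply: filterS (smooth_at_cvg sZ (mnbhs_dom zv)) => w /= /paramK.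
pose proof (dmap_eq (S := model U) u e sZ) as H'.
rewrite /local1 /pull1 (paramK zv); congr (phi _ _).
by rewrite -H' H.
Qed.

(* The second derivatives of [Z] cancel by [schwarz]. *)
Lemma dform1_along (Z : model U -> T) (v0 e e' : U) : smooth_at Z v0 ->
  [/\ sm (fun v => phi (Z v) (dmap Z v e) : R^o) v0 &
  dform1 phi (Z v0) (dmap Z v0 e) (dmap Z v0 e') =
    'd (fun v => phi (Z v) (dmap Z v e') : R^o) v0 e -
    'd (fun v => phi (Z v) (dmap Z v e) : R^o) v0 e'].
Proof.
move=> sZ; pose z := Z v0; have zz : dom z z by exact: dom_refl.
pose g v := chart z (Z v); pose G a w : R^o := local1 z phi a w.
have sg : sm g v0 by exact: smooth_at_model_chart.
have lG a : linear (G a).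
  by move=> k u v; rewrite /G /local1 /pull1 /dmap linearP (sphi.1 _).
have sG w : sm (G^~ w) (g v0).
  exists (chart z @` dom z); split; [|by exists z|exact: sphi.2].
  by pose proof (transition z z).1 as oz; rewrite setIid in oz.
have N w : \forall v \near v0, G (g v) ('d g v w) = phi (Z v) (dmap Z v w).
  have N1 : \forall v \near v0, smooth_at Z v by exact: (smooth_at_near sZ).
  have N2 : \forall v \near v0, dom z (Z v) by exact: sZ.1.
  by apply: filterS2 N1 N2 => v; exact: local1_along.
have [s1 d1] := diff_pairing e' lG sG sg (sm_diff e sg).
have [s2 d2] := diff_pairing e lG sG sg (sm_diff e' sg).
split; first exact: sm_eq (N e) s1.
rewrite [X in _ = X - _](etrans (diff_eq_near e (N e') s2) d2).
rewrite [X in _ = _ - X](etrans (diff_eq_near e' (N e) s1) d1).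
rewrite [X in _ - (_ + G _ X)](schwarz e e' sg) opprD addrACA subrr addr0.
by rewrite /dform1 (_ : 'd g v0 e = dmap Z v0 e) // (_ : 'd g v0 e' = dmap Z v0 e').
Qed.

End Along.

Section FieldForm.
Context {R : realType} {V V' U : normedModType R} {E : charted V} {M : charted V'}.
Context {okE : atlas_ok E} {okM : atlas_ok M}.
Context {fV : findim V} {fV' : findim V'} {fU : findim U}.

(* In direction [e'] the curve in the base is constant, so by horizontality only
   one of the two terms of the exterior derivative of [phi] survives. *)
Lemma form_along (omega : form2 M) (phi : form1 E) (lam pi : E -> M)
    (Z : model U -> E) (v0 e e' : U) :
  smooth_form2 omega -> smooth_form1 phi ->
  (forall z u, dmap pi z u = 0 -> phi z u = 0) ->
  (forall z u v, pull2 lam omega z u v - pull2 pi omega z u v = dform1 phi z u v) ->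
  (forall z, smooth_at lam z) -> (forall z, smooth_at pi z) ->
  (\forall v \near v0, smooth_at Z v) ->
  (\forall v \near v0, dmap (fun w => pi (Z w)) v e' = 0) ->
  omega (lam (Z v0)) (dmap (fun v => lam (Z v)) v0 e) (dmap (fun v => lam (Z v)) v0 e') =
  - 'd (fun v => phi (Z v) (dmap Z v e) : R^o) v0 e'.
Proof.
move=> [lomega _ _ _] sphi hphi dphi slam spi nZ npi.
have sZ : smooth_at Z v0 by exact: nbhs_singleton nZ.
have dpi : dmap (fun w => pi (Z w)) v0 e' = 0 by exact: nbhs_singleton npi.
rewrite !(dmap_comp _ sZ (slam _)).
have [_ D] := dform1_along sphi e e' sZ.
have := dphi (Z v0) (dmap Z v0 e) (dmap Z v0 e'); rewrite D /pull2.
rewrite -[dmap pi (Z v0) (dmap Z v0 e')](dmap_comp _ sZ (spi _)) dpi.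
have -> : omega (pi (Z v0)) (dmap pi (Z v0) (dmap Z v0 e)) 0 = 0.
  exact: (linear0 (pack_linear (lomega _ _))).
rewrite subr0 => ->.
(* The value of [phi] on the velocity in direction [e'] vanishes near [v0] and not merely at it, so
   its derivative drops out. *)
have N : \forall v \near v0, (fun=> 0 : R^o) v = phi (Z v) (dmap Z v e').
  apply: filterS2 nZ npi => v sZv; rewrite (dmap_comp _ sZv (spi _)).
  by move=> /hphi ->.
have E0 := etrans (diff_eq_near e N (sm_cst _ _)) (diff_sm_cst _ _ _).
by rewrite [X in X - _ = _]E0 sub0r.
Qed.

End FieldForm.

(** * The form [dxdy] as a mixed second derivative *)

Section Dxdy.
Context {R : realType} {a b : nat} {X : charted 'rV[R]_a} {Y : charted 'rV[R]_b}.
Context {k l : nat} {okX : atlas_ok X} {okY : atlas_ok Y}.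
Local Notation P := (mprod (mpow k X) (mpow l Y)).
Local Notation V := ('M[R]_(k, a) * 'M[R]_(l, b))%type.

(** A product chart splits at every nearby point, so [dy h] kills [(w1, 0)] there and not only at
    [p]. Of the four terms in the two exterior derivatives a single one survives. *)
Lemma dxdyE (h : P -> R) (p : P) w1 w2 : smooth_at (h : P -> model R^o) p ->
  dxdy h p (w1, 0) (0, w2) =
  'd (fun x : V => 'd (fun y : V => h (param p y) : R^o) x (0, w2)) (chart p p) (w1, 0).
Proof.
move=> sh; have pp : dom p p by exact: dom_refl.
have N1 : \forall x \near chart p p, [/\ dom p (param p x), chart p (param p x) = x
    & smooth_at (h : P -> model R^o) (param p x)].
  pose proof (smooth_at_near sh : \forall x \near chart p p,
    smooth_at (h : P -> model R^o) (param p x)) as N.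
  pose proof (near_chart pp pp) as N'.
  by apply: (nearS2 _ N' N) => x [h1 _ h2] h3; split.
have dparam x w : dom p (param p x) -> chart p (param p x) = x ->
    smooth_at (param p : model V -> P) x /\
    dmap (param p : model V -> P) x w =
    (dmap (param p.1 : model _ -> mpow k X) x.1 w.1,
     dmap (param p.2 : model _ -> mpow l Y) x.2 w.2).
  move=> px cx; have sp : smooth_at (param p : model V -> P) x.
    by rewrite -cx; exact: smooth_at_param.
  have c1 : chart p.1 (param p.1 x.1) = x.1 by have := congr1 fst cx.
  have c2 : chart p.2 (param p.2 x.2) = x.2 by have := congr1 snd cx.
  have s1 : smooth_at (param p.1 : model _ -> mpow k X) x.1.
    by rewrite -c1; exact: (smooth_at_param px.1).
  have s2 : smooth_at (param p.2 : model _ -> mpow l Y) x.2.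
    by rewrite -c2; exact: (smooth_at_param px.2).
  have f1 : smooth_at (fst : model V -> model 'M[R]_(k, a)) x.
    by apply: smooth_at_model; exact: sm_fst.
  have f2 : smooth_at (snd : model V -> model 'M[R]_(l, b)) x.
    by apply: smooth_at_model; exact: sm_snd.
  split=> //.
  pose proof (smooth_at_comp f1 s1) as sf; pose proof (smooth_at_comp f2 s2) as sg.
  apply: (etrans (dmap_pair w sf sg)).
  rewrite (dmap_comp w f1 s1) (dmap_comp w f2 s2).
  by rewrite [X in dmap _ _ X](diff_fst x w) [X in (_, dmap _ _ X)](diff_snd x w).
have L1 : \forall x \near chart p p, 0 = local1 p (dy h) x (w1, 0).
  apply: (nearS _ N1) => x [px cx _].
  have [_ E] := dparam x (w1, 0) px cx.
  by rewrite /local1 /pull1 /dy [dmap _ _ _]E /= dmap0 /dfun dmap0.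
have L2 : \forall x \near chart p p,
    'd (fun y : V => h (param p y) : R^o) x (0, w2) = local1 p (dy h) x (0, w2).
  apply: (nearS _ N1) => x [px cx sx].
  have [sp E] := dparam x (0, w2) px cx.
  have H := dmap_comp (0, w2) sp sx.
  rewrite /local1 /pull1 /dy [dmap _ _ _]E /= /dfun.
  have E' : (0, dmap (param p.2 : model _ -> mpow l Y) x.2 w2) =
      dmap (param p : model V -> P) x (0, w2) by rewrite E /= dmap0.
  by rewrite E' -H.
have sc : sm (fun y : V => h (param p y) : R^o) (chart p p) by exact: sh.2.
have E1 := etrans (diff_eq_near (0, w2) L1 (sm_cst _ _)) (diff_sm_cst _ _ _).
have E2 := diff_eq_near (w1, 0) L2 (sm_diff _ sc).
have E3 (f : V -> R^o) : 'd f (chart p p) ((0, 0) : V) = 0 by exact: linear0.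
apply: (etrans (congr2 (fun x y : R => x + y)
  (congr2 (fun x y : R => x - y) E2 E1) (congr2 (fun x y : R => x - y) (E3 _) (E3 _)))).
by rewrite [X in X + _]subr0 [X in _ + X]subr0; exact: addr0.
Qed.

(** The velocity of the family in direction [(0, 1)] depends on the second parameter only.
    Differentiating it in direction [(1, 0)] gives zero ([E0]), so no acceleration term appears and
    the result depends on the velocities alone. *)
Lemma dxdy_along (h : P -> R) (xx : model R^o -> mpow k X) (yy : model R^o -> mpow l Y)
    (s t : R^o) :
  smooth_at (h : P -> model R^o) ((xx s, yy t) : P) ->
  smooth_at xx s -> smooth_at yy t ->
  sm (fun q : R^o * R^o => h (xx q.1, yy q.2) : R^o) (s, t) /\
  'd (fun q : R^o * R^o => 'd (fun q : R^o * R^o => h (xx q.1, yy q.2) : R^o) q (0, 1))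
    (s, t) (1, 0) =
  dxdy h ((xx s, yy t) : P) (dmap xx s 1, 0) (0, dmap yy t 1).
Proof.
move=> sh sx sy; pose p : P := (xx s, yy t).
pose c (y : V) := h (param p y) : R^o.
pose gx (r : R^o) : 'M[R]_(k, a) := chart (xx s) (xx r).
pose gy (r : R^o) : 'M[R]_(l, b) := chart (yy t) (yy r).
pose g (q : R^o * R^o) : V := (gx q.1, gy q.2).
have sgx : sm gx s by exact: sx.2.
have sgy : sm gy t by exact: sy.2.
have sgx' : sm (fun q : R^o * R^o => gx q.1) (s, t).
  by apply: (sm_comp (f := fst) (g := gx)) => //; exact: sm_fst.
have sgy' : sm (fun q : R^o * R^o => gy q.2) (s, t).
  by apply: (sm_comp (f := snd) (g := gy)) => //; exact: sm_snd.
have sg : sm g (s, t) by exact: sm_pair.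
have sc : sm c (g (s, t)) by exact: sh.2.
have N1 : \forall q \near ((s, t) : R^o * R^o), c (g q) = h (xx q.1, yy q.2).
  have n1 := @near_fst R R^o R^o (s, t) _ sx.1.
  have n2 := @near_snd R R^o R^o (s, t) _ sy.1.
  apply: (nearS2 _ n1 n2) => q /= d1 d2.
  have e : param p (g q) = (xx q.1, yy q.2).
    by apply: injective_projections; [exact: paramK d1|exact: paramK d2].
  by rewrite /c e.
have sK : sm (fun q : R^o * R^o => h (xx q.1, yy q.2) : R^o) (s, t).
  by apply: (sm_eq N1); exact: sm_comp.
split=> //.
have dg q (e : R^o * R^o) : sm gx q.1 -> sm gy q.2 ->
    'd g q e = ('d gx (q.1) e.1, 'd gy (q.2) e.2).
  move=> s1 s2; rewrite diff_sm_pair; first last.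
  - by apply: (sm_comp (f := snd) (g := gy)) => //; exact: sm_snd.
  - by apply: (sm_comp (f := fst) (g := gx)) => //; exact: sm_fst.
  congr pair.
    apply: (etrans (@sm_comp_diff _ _ _ _ _ _ fst gx q e (sm_fst _) s1)).
    by congr ('d _ _ _); exact: diff_fst.
  apply: (etrans (@sm_comp_diff _ _ _ _ _ _ snd gy q e (sm_snd _) s2)).
  by congr ('d _ _ _); exact: diff_snd.
pose dgy (q : R^o * R^o) : V := (0, 'd gy (q.2) 1).
have sdgy : sm (fun q : R^o * R^o => 'd gy (q.2) 1) (s, t).
  by apply: (sm_comp (f := snd) (g := fun r => 'd gy r 1)); [exact: sm_snd|exact:
    sm_diff].
have sdg : sm dgy (s, t) by apply: sm_pair => //; exact: sm_cst.
have N2 : \forall q \near ((s, t) : R^o * R^o),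
    'd c (g q) (dgy q) = 'd (fun q : R^o * R^o => h (xx q.1, yy q.2) : R^o) q (0, 1).
  have n1 := @near_fst R R^o R^o (s, t) _ (sm_near sgx).
  have n2 := @near_snd R R^o R^o (s, t) _ (sm_near sgy).
  have n3 := sm_continuous sg (sm_near sc).
  have n4 : \forall q \near ((s, t) : R^o * R^o), \forall q' \near q,
    c (g q') = h (xx q'.1, yy q'.2) by exact: near_join N1.
  near=> q.
  have s1 : sm gx q.1 by near: q; exact: n1.
  have s2 : sm gy q.2 by near: q; exact: n2.
  have s3 : sm c (g q) by near: q; exact: n3.
  have s4 : \forall q' \near q, c (g q') = h (xx q'.1, yy q'.2) by near: q; exact: n4.
  have sgq : sm g q.
    apply: sm_pair.
      by apply: (sm_comp (f := fst) (g := gx)) => //; exact: sm_fst.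
    by apply: (sm_comp (f := snd) (g := gy)) => //; exact: sm_snd.
  apply: esym; apply: (etrans (diff_eq_near ((0, 1) : R^o * R^o) s4 (sm_comp sgq s3))).
  apply: (etrans (sm_comp_diff _ sgq s3)); congr ('d _ _ _).
  by rewrite (dg _ _ s1 s2) /= linear0.
have lG y : linear ('d c y) by exact: linearP.
have sG w : sm (fun y => 'd c y w) (g (s, t)) by exact: sm_diff.
have [s5 d5] := diff_pairing ((1, 0) : R^o * R^o) lG sG sg sdg.
apply: (etrans (diff_eq_near ((1, 0) : R^o * R^o) N2 s5)); apply: (etrans d5).
have E0 : 'd dgy (s, t) (1, 0) = 0.
  apply: (etrans (diff_sm_pair ((1, 0) : R^o * R^o) (sm_cst 0 _) sdgy)).
  apply: injective_projections => /=; first exact: diff_sm_cst.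
  have s6 : sm (fun r => 'd gy r 1) t by exact: sm_diff.
  apply: (etrans (@sm_comp_diff _ _ _ _ _ _ snd (fun r => 'd gy r 1) (s, t) ((1, 0)
    : R^o * R^o) (sm_snd _) s6)).
  apply: (etrans (congr1 _ (diff_snd _ _))); exact: linear0.
apply: (etrans (congr2 (fun x y : R => x + y)
  (congr1 ('d (fun y => 'd c y (dgy (s, t))) (g (s, t))) (dg (s, t) (1, 0) sgx sgy))
  (congr1 ('d c (g (s, t))) E0))).
apply: (etrans (congr1 (fun y : R => _ + y) (linear0 _))); rewrite addr0 /= linear0.
exact: esym (dxdyE _ _ sh).
Unshelve. all: by end_near. Qed.

End Dxdy.

(** * The differential of the Calabi function *)

Section Horizontal.
Context {R : realType} {V W : normedModType R} {E : charted V} {M : charted W}.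
Context (phi : form1 E) (pi : E -> M).

(* For a horizontal form, the value on any lift of [u]; [xget] defaults to the
   vector 0 when [u] has no lift. *)
Definition hval (z : E) (u : W) : R := phi z (xget 0 [set w | dmap pi z w = u]).

(** Two lifts of the same vector differ by a vertical one, so the choice made by [xget] is
    immaterial. *)
Lemma hvalE z w : (forall z, linear (phi z : V -> R^o)) ->
  (forall z u, dmap pi z u = 0 -> phi z u = 0) ->
  phi z w = hval z (dmap pi z w).
Proof.
move=> lphi hphi; rewrite /hval.
have : dmap pi z (xget 0 [set w' | dmap pi z w' = dmap pi z w]) = dmap pi z w.
  exact: (@xgetPex _ 0 [set w' | dmap pi z w' = dmap pi z w] (ex_intro _ w erefl)).
set w' := xget _ _ => e; apply/eqP; rewrite -subr_eq0; apply/eqP.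
have <- : phi z (w - w') = phi z w - phi z w'.
  exact: (linearB (pack_linear (lphi z))).
by apply: hphi; rewrite /dmap linearB /= -[X in X - _]/(dmap pi z w)
  -[X in _ - X]/(dmap pi z w') e subrr.
Qed.

Lemma hval0 z : (forall z, linear (phi z : V -> R^o)) ->
  (forall z u, dmap pi z u = 0 -> phi z u = 0) -> hval z 0 = 0.
Proof.
move=> lphi hphi; have e : dmap pi z 0 = 0 by rewrite /dmap linear0.
rewrite -{1}e -hvalE //.
exact: (linear0 (pack_linear (lphi z))).
Qed.

End Horizontal.

Lemma dmap_ith (R : realType) (d k : nat) (M : charted 'rV[R]_d) (okM : atlas_ok M)
    (i : 'I_k) (p : mpow k M) w : dmap (fun x : mpow k M => x i) p w = row i w.
Proof.
pose proof (near_rows_chart (p := p) (fun i => near_chart (dom_refl (p i))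
  (dom_refl (p i)))) as N.
have N' : \forall a \near chart p p, row i a = chart (p i) (param p a i).
  by apply: (nearS _ N) => A H; have [_ _ E] := H i; rewrite -[LHS]E.
apply: (etrans (diff_eq_near w N' (sm_row i _))).
apply: diff_linear; first exact: linearP.
by move=> x; exact: (sm_continuous (sm_row i x)).
Qed.

Lemma diff_sm_lincomb (R : realType) (V : normedModType R) (I J : finType)
    (c : I -> J -> R) (f : I -> J -> V -> R^o) (a u : V) :
  (forall i j, sm (f i j) a) ->
  sm (fun x => \sum_i \sum_j (c i j * f i j x : R^o)) a /\
  'd (fun x => \sum_i \sum_j (c i j * f i j x : R^o)) a u =
    \sum_i \sum_j c i j * 'd (f i j) a u.
Proof.
move=> sf.
have s1 i j : sm (fun x => c i j * f i j x : R^o) a by apply: sm_mul => //; exact: sm_cst.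
have s2 i : sm (fun x => \sum_j (c i j * f i j x : R^o)) a.
  exact: (sm_sum (index_enum J) (s1 i)).
split; first exact: (sm_sum (index_enum I) s2).
apply: (etrans (diff_sm_sum (index_enum I) u s2)); apply: eq_bigr => i _.
apply: (etrans (diff_sm_sum (index_enum J) u (s1 i))); apply: eq_bigr => j _.
apply: (etrans (diff_sm_mul u (sm_cst (c i j : R^o) a) (sf i j))).
apply: (etrans (congr1 (fun y : R => c i j * 'd (f i j) a u + f i j a * y)
  (diff_sm_cst (c i j : R^o) a u))).
by rewrite mulr0 addr0.
Qed.

Lemma smooth_at_id (R : realType) (V : normedModType R) (T : charted V)
  (okT : atlas_ok T) (p : T) : smooth_at (fun x : T => x) p.
Proof.
have pp : dom p p by exact: dom_refl.
by split; [exact: mnbhs_dom|exact: sm_transition].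
Qed.

Section Transport.
Context {R : realType} {d : nat} {M : charted 'rV[R]_d} {okM : atlas_ok M}.
Context {V V' : normedModType R} {fV : findim V} {fV' : findim V'}.
Context {E : charted V} {E' : charted V'} {okE : atlas_ok E} {okE' : atlas_ok E'}.
Context {omega : form2 M} {phi : form1 E} {phi' : form1 E'}.
Context {lam pi : E -> M} {lam' pi' : E' -> M}.
Context {gamma : mprod M M -> M} {VG : set (mprod M M)}.
Context {r1 : mprod M M -> E} {r2 : mprod M M -> E'}.
Context {n : nat} {c : 'M[R]_n} {W0 : set (mprod (mpow n M) (mpow n M))}.
Context {C : mprod (mpow n M) (mpow n M) -> R}.
Context (somega : smooth_form2 omega) (sphi : smooth_form1 phi) (sphi' :
  smooth_form1 phi').
Context (hphi : forall z u, dmap pi z u = 0 -> phi z u = 0).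
Context (hphi' : forall z u, dmap pi' z u = 0 -> phi' z u = 0).
Context (dphi : forall z u v,
  pull2 lam omega z u v - pull2 pi omega z u v = dform1 phi z u v).
Context (dphi' : forall z u v,
  pull2 lam' omega z u v - pull2 pi' omega z u v = dform1 phi' z u v).
Context (slam : forall z, smooth_at lam z) (spi : forall z, smooth_at pi z).
Context (slam' : forall z, smooth_at lam' z) (spi' : forall z, smooth_at pi' z).
Context (oVG : mopen VG).
Context (sr1 : forall p, VG p -> smooth_at r1 p) (sr2 : forall p, VG p -> smooth_at r2 p).
Context (pr1 : forall p, VG p -> pi (r1 p) = p.1) (pr2 : forall p, VG p -> pi' (r2
  p) = p.2).
Context (gr1 : forall p, VG p -> gamma p = lam (r1 p)).
Context (gr2 : forall p, VG p -> gamma p = lam' (r2 p)).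
Context (calC : calabi VG (pull2 gamma omega) c W0 C).

Local Notation P := (mprod (mpow n M) (mpow n M)).
Local Notation R2 := (R^o * R^o)%type.

Lemma smooth_C p : W0 p -> smooth_at (C : P -> model R^o) p.
Proof. by case: calC => -[oW0 _] _ sC _ _; exact: smooth_on_at. Qed.

Lemma smooth_pi i j (p : P) : smooth_at (pi_ i j) p.
Proof.
apply: smooth_at_pair.
  apply: (smooth_at_comp (f := fst : P -> _) (g := fun x : mpow n M => x i)).
    exact: smooth_at_fst.
  exact: smooth_at_ith.
apply: (smooth_at_comp (f := snd : P -> _) (g := fun x : mpow n M => x j)).
  exact: smooth_at_snd.
exact: smooth_at_ith.
Qed.

Lemma smooth_gamma p : VG p -> smooth_at gamma p.
Proof.
move=> VGp; have N : mnbhs p VG by exact: ((mopenP VG).1 oVG).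
apply: (smooth_at_eq (f := fun x => lam (r1 x))).
  by apply: filterS N => x /gr1.
exact: (smooth_at_comp (sr1 VGp) (slam _)).
Qed.

(** * Product families of two curves *)

Section Family.
Context (xx yy : model R^o -> mpow n M).

Let X (q : model R2) : P := (xx q.1, yy q.2).
Let K (q : R2) : R^o := C (xx q.1, yy q.2).
Let Z1 (i j : 'I_n) (q : model R2) : E := r1 (xx q.1 i, yy q.2 j).
Let Z2 (i j : 'I_n) (q : model R2) : E' := r2 (xx q.1 i, yy q.2 j).

(** Smoothness is asked only at the two parameters in question, because the chart segments used
    later need be smooth only while they stay in their chart ball. *)
Definition regular (q : R2) :=
  [/\ smooth_at xx q.1, smooth_at yy q.2 & W0 (xx q.1, yy q.2)].

Lemma smooth_X1 q : smooth_at xx q.1 -> smooth_at (fun q : model R2 => xx q.1) q.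
Proof.
apply: (smooth_at_comp (f := fst : model R2 -> model R^o) (g := xx)) => //.
by apply: smooth_at_model; exact: sm_fst.
Qed.

Lemma smooth_X2 q : smooth_at yy q.2 -> smooth_at (fun q : model R2 => yy q.2) q.
Proof.
apply: (smooth_at_comp (f := snd : model R2 -> model R^o) (g := yy)) => //.
by apply: smooth_at_model; exact: sm_snd.
Qed.

Lemma smooth_X q : regular q -> smooth_at X q.
Proof.
by case=> sx sy _; apply: smooth_at_pair; [exact: smooth_X1|exact: smooth_X2].
Qed.

Lemma dmap_X q (e : R2) : regular q -> dmap X q e = (dmap xx q.1 e.1, dmap yy q.2 e.2).
Proof.
case=> sx sy _; apply: (etrans (dmap_pair e (smooth_X1 sx) (smooth_X2 sy))).
have f1 : smooth_at (fst : model R2 -> model R^o) q.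
  by apply: smooth_at_model; exact: sm_fst.
have f2 : smooth_at (snd : model R2 -> model R^o) q.
  by apply: smooth_at_model; exact: sm_snd.
congr pair.
  apply: (etrans (dmap_comp (f := fst : model R2 -> model R^o) e f1 sx)).
  by congr (dmap _ _ _); exact: diff_fst.
apply: (etrans (dmap_comp (f := snd : model R2 -> model R^o) e f2 sy)).
by congr (dmap _ _ _); exact: diff_snd.
Qed.

Lemma near_regular q : regular q -> \forall q' \near q, regular q'.
Proof.
move=> rq; have [sx sy Wq] := rq.
have n1 := @near_fst R R^o R^o q _ (smooth_at_near sx).
have n2 := @near_snd R R^o R^o q _ (smooth_at_near sy).
have oW0 : mopen W0 by case: calC => -[].
have N : mnbhs (X q) W0 by exact: ((mopenP W0).1 oW0).
pose proof (smooth_at_cvg (smooth_X rq) N : \forall q' \near q, W0 (X q')) as n3.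
near=> q'; split; near: q'; [exact: n1|exact: n2|exact: n3].
Unshelve. all: by end_near. Qed.

Lemma regular_VG i j q : regular q -> VG (xx q.1 i, yy q.2 j).
Proof. by case=> _ _ Wq; case: calC => _ /(_ _ i j Wq). Qed.

Lemma smooth_Z1 i j q : regular q -> smooth_at (Z1 i j) q.
Proof.
move=> rq; apply: (smooth_at_comp (f := fun q => pi_ i j (X q)) (g := r1)).
  apply: (smooth_at_comp (f := X)); [exact: smooth_X|exact: smooth_pi].
exact/sr1/(regular_VG i j rq).
Qed.

Lemma smooth_Z2 i j q : regular q -> smooth_at (Z2 i j) q.
Proof.
move=> rq; apply: (smooth_at_comp (f := fun q => pi_ i j (X q)) (g := r2)).
  apply: (smooth_at_comp (f := X)); [exact: smooth_X|exact: smooth_pi].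
exact/sr2/(regular_VG i j rq).
Qed.

Lemma dmap_xi i q e : regular q ->
  dmap (fun q : model R2 => xx q.1 i) q e = row i (dmap xx q.1 e.1).
Proof.
move=> [sx sy _]; have f1 : smooth_at (fst : model R2 -> model R^o) q.
  by apply: smooth_at_model; exact: sm_fst.
apply: (etrans (dmap_comp (g := fun x : mpow n M => x i) e (smooth_X1 sx)
  (smooth_at_ith i _))).
rewrite dmap_ith; congr row.
apply: (etrans (dmap_comp (f := fst : model R2 -> model R^o) e f1 sx)).
by congr (dmap _ _ _); exact: diff_fst.
Qed.

Lemma dmap_yj j q e : regular q ->
  dmap (fun q : model R2 => yy q.2 j) q e = row j (dmap yy q.2 e.2).
Proof.
move=> [sx sy _]; have f1 : smooth_at (snd : model R2 -> model R^o) q.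
  by apply: smooth_at_model; exact: sm_snd.
apply: (etrans (dmap_comp (g := fun x : mpow n M => x j) e (smooth_X2 sy)
  (smooth_at_ith j _))).
rewrite dmap_ith; congr row.
apply: (etrans (dmap_comp (f := snd : model R2 -> model R^o) e f1 sy)).
by congr (dmap _ _ _); exact: diff_snd.
Qed.

Lemma dmap_piZ1 i j q e : regular q ->
  dmap (fun q : model R2 => pi (Z1 i j q)) q e = row i (dmap xx q.1 e.1).
Proof.
move=> rq; rewrite -(dmap_xi i e rq); have [sx _ _] := rq.
apply: (dmap_eq (f := fun q : model R2 => xx q.1 i)).
  have N := near_regular rq.
  by apply: (nearS _ N) => q' rq'; apply: esym; exact: (pr1 (regular_VG i j rq')).
apply: (smooth_at_comp (f := fun q : model R2 => xx q.1)
  (g := fun x : mpow n M => x i)); [exact: smooth_X1|exact: smooth_at_ith].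
Qed.

Lemma dmap_piZ2 i j q e : regular q ->
  dmap (fun q : model R2 => pi' (Z2 i j q)) q e = row j (dmap yy q.2 e.2).
Proof.
move=> rq; rewrite -(dmap_yj j e rq); have [_ sy _] := rq.
apply: (dmap_eq (f := fun q : model R2 => yy q.2 j)).
  have N := near_regular rq.
  by apply: (nearS _ N) => q' rq'; apply: esym; exact: (pr2 (regular_VG i j rq')).
apply: (smooth_at_comp (f := fun q : model R2 => yy q.2)
  (g := fun x : mpow n M => x j)); [exact: smooth_X2|exact: smooth_at_ith].
Qed.

Lemma pull_pi i j q e e' : regular q ->
  pull2 (pi_ i j) (pull2 gamma omega) (X q) (dmap X q e) (dmap X q e') =
  omega (gamma (pi_ i j (X q))) (dmap (fun q => gamma (pi_ i j (X q))) q e)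
    (dmap (fun q => gamma (pi_ i j (X q))) q e').
Proof.
move=> rq; have sX := smooth_X rq.
have sG : smooth_at gamma (pi_ i j (X q)) by exact/smooth_gamma/(regular_VG i j rq).
have eqE w : dmap gamma (pi_ i j (X q)) (dmap (pi_ i j) (X q) (dmap X q w)) =
    dmap (fun q => gamma (pi_ i j (X q))) q w.
  apply: esym; apply: (etrans (dmap_comp (f := X) w sX
    (smooth_at_comp (smooth_pi i j _) sG))).
  exact: dmap_comp (smooth_pi i j _) sG.
by rewrite /pull2 !eqE.
Qed.

Lemma gammaZ1 i j q e : regular q ->
  gamma (pi_ i j (X q)) = lam (Z1 i j q) /\
  dmap (fun q => gamma (pi_ i j (X q))) q e = dmap (fun q => lam (Z1 i j q)) q e.
Proof.
move=> rq; split; first exact: (gr1 (regular_VG i j rq)).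
apply: dmap_eq; last exact: (smooth_at_comp (smooth_Z1 i j rq)).
have N := near_regular rq.
by apply: (nearS _ N) => q' rq'; apply: esym; exact: (gr1 (regular_VG i j rq')).
Qed.

Lemma gammaZ2 i j q e : regular q ->
  gamma (pi_ i j (X q)) = lam' (Z2 i j q) /\
  dmap (fun q => gamma (pi_ i j (X q))) q e = dmap (fun q => lam' (Z2 i j q)) q e.
Proof.
move=> rq; split; first exact: (gr2 (regular_VG i j rq)).
apply: dmap_eq; last exact: (smooth_at_comp (smooth_Z2 i j rq)).
have N := near_regular rq.
by apply: (nearS _ N) => q' rq'; apply: esym; exact: (gr2 (regular_VG i j rq')).
Qed.

Lemma sm_Z1 i j q e : regular q ->
  sm (fun q => phi (Z1 i j q) (dmap (Z1 i j) q e) : R^o) q.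
Proof. by move=> rq; have [] := dform1_along sphi e e (smooth_Z1 i j rq). Qed.

Lemma sm_Z2 i j q e : regular q ->
  sm (fun q => phi' (Z2 i j q) (dmap (Z2 i j) q e) : R^o) q.
Proof. by move=> rq; have [] := dform1_along sphi' e e (smooth_Z2 i j rq). Qed.

(** [Z1 i j] lies over the curve [xx], which stands still in direction [(0, 1)]; this is the
    stationary direction required by [form_along]. *)
Lemma pullZ1 i j q : regular q ->
  pull2 (pi_ i j) (pull2 gamma omega) (X q) (dmap X q (1, 0)) (dmap X q (0, 1)) =
  - 'd (fun q => phi (Z1 i j q) (dmap (Z1 i j) q (1, 0)) : R^o) q (0, 1).
Proof.
move=> rq; have N := near_regular rq.
apply: (etrans (pull_pi i j _ _ rq)).
rewrite (gammaZ1 i j (1, 0) rq).1 (gammaZ1 i j (1, 0) rq).2 (gammaZ1 i j (0, 1) rq).2.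
apply: (form_along (Z := Z1 i j) (v0 := q) (e' := (0, 1)) (1, 0)
  somega sphi hphi dphi slam spi).
  by apply: (nearS _ N) => q' rq'; exact: smooth_Z1.
by apply: (nearS _ N) => q' rq'; rewrite (dmap_piZ1 i j _ rq') dmap0 linear0.
Qed.

(** Now the base curve is [yy] and the stationary direction is [(1, 0)]. The arguments of [omega]
    must be swapped before [form_along] applies, which accounts for the sign opposite to
    [pullZ1]. *)
Lemma pullZ2 i j q : regular q ->
  pull2 (pi_ i j) (pull2 gamma omega) (X q) (dmap X q (1, 0)) (dmap X q (0, 1)) =
  'd (fun q => phi' (Z2 i j q) (dmap (Z2 i j) q (0, 1)) : R^o) q (1, 0).
Proof.
move=> rq; have N := near_regular rq.
apply: (etrans (pull_pi i j _ _ rq)).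
rewrite (gammaZ2 i j (1, 0) rq).1 (gammaZ2 i j (1, 0) rq).2 (gammaZ2 i j (0, 1) rq).2.
case: somega => _ _ asym _; rewrite asym; apply: (canLR (@opprK _)).
apply: (form_along (Z := Z2 i j) (v0 := q) (e' := (1, 0)) (0, 1)
  somega sphi' hphi' dphi' slam' spi').
  by apply: (nearS _ N) => q' rq'; exact: smooth_Z2.
by apply: (nearS _ N) => q' rq'; rewrite (dmap_piZ2 i j _ rq') dmap0 linear0.
Qed.

Lemma sm_K q : regular q -> sm K q.
Proof.
case: q => s t [sx sy Wq]; exact: (dxdy_along (smooth_C Wq) sx sy).1.
Qed.

(** The two velocities have the pure types (w, 0) and (0, w'), which is where [dxdy_along] meets the
    defining equation of a Calabi function. *)
Lemma diff2_K q : regular q -> 'd (fun q => 'd K q (0, 1)) q (1, 0) =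
  \sum_i \sum_j c i j * pull2 (pi_ i j) (pull2 gamma omega) (X q)
    (dmap X q (1, 0)) (dmap X q (0, 1)).
Proof.
move=> rq; case: q rq => s t rq; have [sx sy Wq] := rq.
rewrite !(dmap_X _ rq) /= !dmap0.
have [_ _ _ ->] := calC; last by [].
by move=> _; exact: (dxdy_along (smooth_C Wq) sx sy).2.
Qed.

(* [defect1] and [defect2] compare the derivative of [C] along a curve in one
   factor with the pulled-back horizontal form; both are constant in the other
   factor and vanish where that factor reaches the diagonal. *)
Definition defect1 (q : R2) : R^o := 'd K q (1, 0) +
  \sum_i \sum_j (c i j * phi (Z1 i j q) (dmap (Z1 i j) q (1, 0)) : R^o).

Definition defect2 (q : R2) : R^o := 'd K q (0, 1) -
  \sum_i \sum_j (c i j * phi' (Z2 i j q) (dmap (Z2 i j) q (0, 1)) : R^o).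

(** The second derivative of [K] occurs here in the order opposite to [diff2_K], hence [schwarz];
    the plus sign in [defect1] answers the minus sign in [pullZ1]. *)
Lemma defect1_flat q : regular q -> sm defect1 q /\ 'd defect1 q (0, 1) = 0.
Proof.
move=> rq; have sK := sm_K rq.
have [s1 d1] := @diff_sm_lincomb _ _ _ _ (fun i j => c i j)
  (fun i j q => phi (Z1 i j q) (dmap (Z1 i j) q (1, 0))) q (0, 1) (fun i j => sm_Z1
    i j _ rq).
have s2 := sm_diff ((1, 0) : R2) sK.
split; first exact: sm_add.
apply: (etrans (diff_sm_add _ s2 s1)); apply: (etrans (congr2 +%R
  (etrans (schwarz _ _ sK) (diff2_K rq)) d1)).
rewrite -big_split big1 //= => i _; rewrite -big_split big1 //= => j _.
by rewrite (pullZ1 i j rq) mulrN addNr.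
Qed.

Lemma defect2_flat q : regular q -> sm defect2 q /\ 'd defect2 q (1, 0) = 0.
Proof.
move=> rq; have sK := sm_K rq.
have [s1 d1] := @diff_sm_lincomb _ _ _ _ (fun i j => c i j)
  (fun i j q => phi' (Z2 i j q) (dmap (Z2 i j) q (0, 1))) q (1, 0) (fun i j =>
    sm_Z2 i j _ rq).
have s2 := sm_diff ((0, 1) : R2) sK.
split; first by apply: sm_add => //; exact: sm_opp.
apply: (etrans (diff_sm_sub _ s2 s1)); apply: (etrans (congr2 (fun x y : R => x - y)
  (diff2_K rq) d1)).
apply/eqP; rewrite subr_eq0; apply/eqP.
by apply: eq_bigr => i _; apply: eq_bigr => j _; rewrite (pullZ2 i j rq).
Qed.

(** Horizontality removes the motion of the lift: only the pair of points and the velocity of the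
    base curve remain. Terms with different [j] thereby become equal once the entries of [yy]
    coincide. *)
Lemma phiZ1 i j q : regular q -> phi (Z1 i j q) (dmap (Z1 i j) q (1, 0)) =
  hval phi pi (r1 (xx q.1 i, yy q.2 j)) (row i (dmap xx q.1 1)).
Proof.
move=> rq; rewrite (hvalE _ _ sphi.1 hphi); congr hval.
by rewrite -(dmap_piZ1 i j (1, 0) rq) (dmap_comp _ (smooth_Z1 i j rq) (spi _)).
Qed.

Lemma phiZ2 i j q : regular q -> phi' (Z2 i j q) (dmap (Z2 i j) q (0, 1)) =
  hval phi' pi' (r2 (xx q.1 i, yy q.2 j)) (row j (dmap yy q.2 1)).
Proof.
move=> rq; rewrite (hvalE _ _ sphi'.1 hphi'); congr hval.
by rewrite -(dmap_piZ2 i j (0, 1) rq) (dmap_comp _ (smooth_Z2 i j rq) (spi' _)).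
Qed.

(** Moving in direction [(1, 0)] keeps the second factor on its diagonal, where [C] vanishes for
    every value of the first factor. *)
Lemma diffK_const1 q : regular q -> (forall j j', yy q.2 j = yy q.2 j') ->
  'd K q (1, 0) = 0.
Proof.
move=> rq cy.
have q0 : q + (0 : R) *: ((1, 0) : R2) = q by rewrite scale0r addr0.
have dK : differentiable K (q + (0 : R) *: ((1, 0) : R2)).
  by rewrite q0; exact/sm_differentiable/sm_K.
have [_ H] := diff_line dK; have := H 1; rewrite scale1r q0 => <-.
have c0 : (q + t *: ((1, 0) : R2)) @[t --> (0 : R^o)] --> q.
  rewrite -[X in _ --> X]q0; apply: cvgD; first exact: cvg_cst.
  by apply: cvgZl; exact: cvg_id.
have N : \forall t \near (0 : R^o), (fun=> 0 : R^o) t = K (q + t *: ((1, 0) : R2)).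
  have := c0 _ (near_regular rq); apply: (@filterS _ (nbhs (0 : R^o))) => t [_ _ W].
  have [_ _ _ _ C0] := calC; apply: esym; apply: C0 => //; right => j j' /=.
  by rewrite scaler0 addr0.
apply: (etrans (diff_eq_near _ N (sm_cst _ _))); exact: diff_sm_cst.
Qed.

Lemma diffK_const2 q : regular q -> (forall i i', xx q.1 i = xx q.1 i') ->
  'd K q (0, 1) = 0.
Proof.
move=> rq cx.
have q0 : q + (0 : R) *: ((0, 1) : R2) = q by rewrite scale0r addr0.
have dK : differentiable K (q + (0 : R) *: ((0, 1) : R2)).
  by rewrite q0; exact/sm_differentiable/sm_K.
have [_ H] := diff_line dK; have := H 1; rewrite scale1r q0 => <-.
have c0 : (q + t *: ((0, 1) : R2)) @[t --> (0 : R^o)] --> q.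
  rewrite -[X in _ --> X]q0; apply: cvgD; first exact: cvg_cst.
  by apply: cvgZl; exact: cvg_id.
have N : \forall t \near (0 : R^o), (fun=> 0 : R^o) t = K (q + t *: ((0, 1) : R2)).
  have := c0 _ (near_regular rq); apply: (@filterS _ (nbhs (0 : R^o))) => t [_ _ W].
  have [_ _ _ _ C0] := calC; apply: esym; apply: C0 => //; left => i i' /=.
  by rewrite scaler0 addr0.
apply: (etrans (diff_eq_near _ N (sm_cst _ _))); exact: diff_sm_cst.
Qed.

(** [defect1] has derivative zero along the segment from [(s, 0)] to [(s, 1)] and vanishes at its
    far end; the mean value theorem takes the place of an integration. *)
Lemma diffK1 (s : R) : (forall t : R, 0 <= t <= 1 -> regular (s, t)) ->
  (forall j j', yy 1 j = yy 1 j') -> (forall i, \sum_j c i j = 0) ->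
  'd K (s, 0) (1, 0) =
  - \sum_i \sum_j c i j * hval phi pi (r1 (xx s i, yy 0 j)) (row i (dmap xx s 1)).
Proof.
move=> reg cy c0.
have r0 : regular (s, 0) by apply: reg; rewrite lexx ler01.
have r1' : regular (s, 1) by apply: reg; rewrite lexx ler01.
have line (t : R) : ((s, 0) : R2) + t *: ((0, 1) : R2) = (s, t).
  by apply: injective_projections; rewrite /= ?scaler0 ?addr0 ?add0r // [_ *: _]mulr1.
(* At time 1 all entries of [yy] agree, so [yy 1 i] may stand for each of them and the row sum
   factors out. *)
have F11 : defect1 (s, 1) = 0.
  rewrite /defect1 diffK_const1 // add0r big1 // => i _.
  transitivity ((\sum_j c i j) *
    hval phi pi (r1 (xx s i, yy 1 i)) (row i (dmap xx s 1))).
    rewrite big_distrl; apply: eq_bigr => j _.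
    by rewrite (phiZ1 i j r1') (cy j i).
  by rewrite c0 mul0r.
have [|t t01 e1] := @MVT_line _ _ defect1 (s, 0) (0, 1) 1 ltr01.
  move=> t t01; rewrite line; apply: sm_differentiable; exact: (defect1_flat (reg t
    t01)).1.
have t01' : 0 <= t <= 1 by case/andP: t01 => *; rewrite !ltW.
rewrite (line 1) (line t) F11 in e1.
have /eqP := etrans e1 (congr1 (fun y : R => 1 * y) (defect1_flat (reg t t01')).2).
rewrite mulr0 sub0r oppr_eq0 => /eqP e0.
apply: (etrans (canRL (addrK _) e0)); rewrite sub0r; congr (- _).
by apply: eq_bigr => i _; apply: eq_bigr => j _; rewrite (phiZ1 i j r0).
Qed.

Lemma diffK2 (t : R) : (forall s : R, 0 <= s <= 1 -> regular (s, t)) ->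
  (forall i i', xx 1 i = xx 1 i') -> (forall j, \sum_i c i j = 0) ->
  'd K (0, t) (0, 1) =
  \sum_i \sum_j c i j * hval phi' pi' (r2 (xx 0 i, yy t j)) (row j (dmap yy t 1)).
Proof.
move=> reg cx c0.
have r0 : regular (0, t) by apply: reg; rewrite lexx ler01.
have r1' : regular (1, t) by apply: reg; rewrite lexx ler01.
have line (s : R) : ((0, t) : R2) + s *: ((1, 0) : R2) = (s, t).
  by apply: injective_projections; rewrite /= ?scaler0 ?addr0 ?add0r // [_ *: _]mulr1.
(* The velocity carries the index [j] here, so the sums are exchanged and it is the column sum that
   factors out. *)
have F21 : defect2 (1, t) = 0.
  rewrite /defect2 diffK_const2 // sub0r exchange_big big1 ?oppr0 // => j _.
  transitivity ((\sum_i c i j) *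
    hval phi' pi' (r2 (xx 1 j, yy t j)) (row j (dmap yy t 1))).
    rewrite big_distrl; apply: eq_bigr => i _.
    by rewrite (phiZ2 i j r1') (cx i j).
  by rewrite c0 mul0r.
have [|s s01 e1] := @MVT_line _ _ defect2 (0, t) (1, 0) 1 ltr01.
  move=> s s01; rewrite line; apply: sm_differentiable; exact: (defect2_flat (reg s
    s01)).1.
have s01' : 0 <= s <= 1 by case/andP: s01 => *; rewrite !ltW.
rewrite (line 1) (line s) F21 in e1.
have /eqP := etrans e1 (congr1 (fun y : R => 1 * y) (defect2_flat (reg s s01')).2).
rewrite mulr0 sub0r oppr_eq0 => /eqP e0.
apply: (etrans (canRL (subrK _) e0)); rewrite add0r.
by apply: eq_bigr => i _; apply: eq_bigr => j _; rewrite (phiZ2 i j r0).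
Qed.

End Family.

(** * Restriction of [C] to the diagonal of M^n x M^n *)

Section Diagonal.
Context (x : mpow n M) (k : 'I_n) (u : 'rV[R]_d).

Let curve (s : model R^o) : mpow n M :=
  [eta x with k |-> param (x k) (chart (x k) (x k) + (s : R) *: u)].

Lemma curve0 : curve 0 = x.
Proof.
apply/funext => i; rewrite /curve /= scale0r addr0 (paramK (dom_refl _)).
by case: eqP => // ->.
Qed.

Lemma diff_affine (a : 'rV[R]_d) (s w : R^o) :
  sm (fun s : R^o => a + (s : R) *: u) s /\ 'd (fun s : R^o => a + (s : R) *: u) s
    w = w *: u.
Proof.
have l : linear (fun s : R^o => (s : R) *: u) by move=> b s1 s2; rewrite scalerDl scalerA.
have c' : continuous (fun s : R^o => (s : R) *: u) by exact: scalel_continuous.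
have s' : sm (fun s : R^o => (s : R) *: u) s by exact: sm_lin.
split; first by apply: sm_add => //; exact: sm_cst.
apply: (etrans (diff_sm_add w (sm_cst a s) s')).
apply: (etrans (congr2 +%R (diff_sm_cst a s w) (diff_linear s w l c'))).
exact: add0r.
Qed.

Lemma smooth_curve_k : smooth_at (fun s : model R^o =>
    param (x k) (chart (x k) (x k) + (s : R) *: u)) 0 /\
  dmap (fun s : model R^o => param (x k) (chart (x k) (x k) + (s : R) *: u)) 0 1 = u.
Proof.
have [sa da] := diff_affine (chart (x k) (x k)) 0 1.
have s1 : smooth_at (fun s : model R^o =>
    chart (x k) (x k) + (s : R) *: u : model 'rV[R]_d) 0 by exact: smooth_at_model.
have e0 : chart (x k) (x k) + (0 : R) *: u = chart (x k) (x k).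
  by rewrite scale0r addr0.
have xx : dom (x k) (x k) by exact: dom_refl.
have s2 : smooth_at (param (x k) : model 'rV[R]_d -> M)
    (chart (x k) (x k) + (0 : R) *: u).
  by rewrite e0; exact: smooth_at_param.
split; first exact: (smooth_at_comp s1 s2).
apply: (etrans (dmap_comp (S := model R^o) (T := model 'rV[R]_d) (Q := M)
  (f := fun s : model R^o => chart (x k) (x k) + (s : R) *: u : model 'rV[R]_d)
  (g := param (x k)) (1 : R^o) s1 s2)).
rewrite [X in dmap _ _ X]da scale1r e0.
have N : \forall a \near chart (x k) (x k), a = chart (x k) (param (x k) a).
  by apply: (nearS _ (near_chart xx xx)) => a [_ _ E1]; rewrite -[LHS]E1.
rewrite /dmap /= (paramK xx).
apply: (etrans (diff_eq_near u N (sm_id _))).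
by apply: diff_linear => // y; exact: cvg_id.
Qed.

Lemma smooth_curve : smooth_at curve 0.
Proof.
apply: smooth_at_comp_pow => i; rewrite /curve /=.
by case: eqP => _; [exact: smooth_curve_k.1|exact: smooth_at_cst].
Qed.

Lemma dmap_curve i : row i (dmap curve 0 1) = if i == k then u else 0.
Proof.
pose proof (dmap_comp (f := curve) (g := fun y : mpow n M => y i) (1 : R^o)
  smooth_curve (smooth_at_ith i _)) as H.
rewrite dmap_ith in H; rewrite -H /curve /=.
by case: eqP => _; [exact: smooth_curve_k.2|exact: dmap_cst].
Qed.

Let subst (y : M) : mpow n M := [eta x with k |-> y].
Let g (y : M) : R^o := C (subst y, subst y).

Lemma smooth_g : W0 (x, x) -> smooth_at (g : M -> model R^o) (x k).
Proof.
move=> Wx; have sj : smooth_at subst (x k).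
  apply: smooth_at_comp_pow => i; rewrite /subst /=; case: eqP => _; last exact:
    smooth_at_cst.
  exact: smooth_at_id.
have ex : subst (x k) = x by apply/funext => i; rewrite /subst /=; case: eqP => // ->.
apply: (smooth_at_comp (f := fun y : M => (subst y, subst y) : P)).
  exact: smooth_at_pair.
by apply: smooth_C; rewrite ex.
Qed.

(** Moving the point [k] in both copies at once splits into a motion in the first copy and one in
    the second. In each case the resting copy is then deformed along [path] to the diagonal, by
    [diffK1] and [diffK2]. *)
Lemma dfun_diagonal (path : model R^o -> mpow n M) :
  path 0 = x -> (forall i j, path 1 i = path 1 j) ->
  (forall t : R, 0 <= t <= 1 ->
    [/\ smooth_at path t, W0 (x, path t) & W0 (path t, x)]) ->
  (forall i, \sum_j c i j = 0) -> (forall j, \sum_i c i j = 0) ->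
  dfun g (x k) u = \sum_i c i k * hval phi' pi' (r2 (x i, x k)) u -
    \sum_j c k j * hval phi pi (r1 (x k, x j)) u.
Proof.
move=> p0 p1 reg rowc colc.
have reg1 (t : R) : 0 <= t <= 1 -> regular curve path (0, t).
  by move=> /reg[h1 h2 h3]; split=> //=; [exact: smooth_curve|rewrite curve0].
have reg2 (s : R) : 0 <= s <= 1 -> regular path curve (s, 0).
  by move=> /reg[h1 h2 h3]; split=> //=; [exact: smooth_curve|rewrite curve0].
have z01 : 0 <= (0 : R) <= 1 by rewrite lexx ler01.
have Wx : W0 (x, x) by case: (reg 0 z01); rewrite p0.
have reg0 : regular curve curve (0, 0).
  by split=> /=; [exact: smooth_curve|exact: smooth_curve|rewrite curve0].
pose K (xx yy : model R^o -> mpow n M) (q : R2) : R^o := C (xx q.1, yy q.2).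
have line xx yy (e : R2) : regular xx yy (0, 0) ->
    'd (fun t : R^o => K xx yy ((0, 0) + (t : R) *: e)) 0 1 = 'd (K xx yy) (0, 0) e.
  move=> r0; have e0 : ((0, 0) : R2) + (0 : R) *: e = (0, 0) by rewrite scale0r addr0.
  have dK : differentiable (K xx yy) (((0, 0) : R2) + (0 : R) *: e).
    by rewrite e0; exact/sm_differentiable/sm_K.
  by have [_ /(_ 1)] := diff_line dK; rewrite scale1r e0.
(* A derivative in the first parameter at [(0, 0)] sees the second curve only through its value at
   0, so [curve] may be traded for [path], which also starts at [x] but reaches the diagonal. *)
have E1 : 'd (K curve curve) (0, 0) (1, 0) = 'd (K curve path) (0, 0) (1, 0).
  have l0 := line curve curve ((1, 0) : R2) reg0.
  have l1 := line curve path ((1, 0) : R2) (reg1 0 z01).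
  rewrite -[LHS]l0 -[RHS]l1; congr ('d _ _ _).
  apply/funext => t; rewrite /K /= scaler0 addr0.
  by rewrite curve0 p0.
have E2 : 'd (K curve curve) (0, 0) (0, 1) = 'd (K path curve) (0, 0) (0, 1).
  have l0 := line curve curve ((0, 1) : R2) reg0.
  have l1 := line path curve ((0, 1) : R2) (reg2 0 z01).
  rewrite -[LHS]l0 -[RHS]l1; congr ('d _ _ _).
  apply/funext => t; rewrite /K /= scaler0 addr0.
  by rewrite curve0 p0.
(* The same point moving in both copies traces the line [(t, t)] of the parameter plane, hence the
   direction [(1, 1)]. *)
have E3 : dfun g (x k) u = 'd (K curve curve) (0, 0) (1, 1).
  have l0 := line curve curve ((1, 1) : R2) reg0; rewrite -[RHS]l0.
  have sg : sm (fun a => g (param (x k) a)) (chart (x k) (x k)) by exact: (smooth_g Wx).2.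
  have ea : chart (x k) (x k) + (0 : R) *: u = chart (x k) (x k) by rewrite scale0r addr0.
  have dg : differentiable (fun a => g (param (x k) a)) (chart (x k) (x k) + (0 :
    R) *: u).
    by rewrite ea; exact: sm_differentiable.
  have [_ /(_ 1)] := diff_line dg; rewrite scale1r ea => H.
  have EF : (fun t : R^o => g (param (x k) (chart (x k) (x k) + (t : R) *: u))) =
      (fun t : R^o => K curve curve ((0, 0) + (t : R) *: ((1, 1) : R2))).
    apply/funext => t; have -> : ((0, 0) : R2) + (t : R) *: ((1, 1) : R2) = (t, t).
      by apply: injective_projections; rewrite /= add0r [_ *: _]mulr1.
    by [].
  by rewrite -[LHS]H EF.
have D : 'd (K curve curve) (0, 0) (1, 1) =
    'd (K curve curve) (0, 0) (1, 0) + 'd (K curve curve) (0, 0) (0, 1).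
  rewrite -linearD; congr ('d _ _ _).
  by apply: injective_projections; rewrite /= ?addr0 ?add0r.
apply: (etrans E3); apply: (etrans D); apply: (etrans (congr2 +%R
  (etrans E1 (diffK1 reg1 p1 rowc)) (etrans E2 (diffK2 reg2 p1 colc)))).
rewrite curve0 p0 addrC.
(* [curve] moves the entry [k] only; all other terms carry the velocity 0, on which [hval]
   vanishes. *)
congr (_ - _).
  apply: eq_bigr => i _; rewrite (bigD1 k) //= big1 ?addr0 => [|j jk].
    by rewrite dmap_curve eqxx.
  by rewrite dmap_curve (negbTE jk) (hval0 _ sphi'.1 hphi') mulr0.
rewrite (bigD1 k) //= [X in _ + X]big1 ?addr0 => [|i ik].
  by apply: eq_bigr => j _; rewrite dmap_curve eqxx.
by apply: big1 => j _; rewrite dmap_curve (negbTE ik) (hval0 _ sphi.1 hphi) mulr0.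
Qed.

End Diagonal.
End Transport.

(** * The covector-valued map chi *)

Section Sine.
Context {R : realType}.

(** The span of sine and cosine is closed under differentiation, which makes the induction on the
    order work. *)
Lemma Ck_sin_cos k (a b : R) :
  Ck k setT (fun t : R^o => a * sin t + b * cos t : R^o).
Proof.
have dl (t a' b' : R) : is_derive t (1 : R) (fun t : R => a' * sin t + b' * cos t)
    (a' * cos t + b' * (- sin t)).
  exact: (is_deriveD (f := a' *: (@sin R)) (g := b' *: (@cos R))).
have dd a' b' (t : R) : derivable (fun t : R => a' * sin t + b' * cos t) t 1.
  exact: (@ex_derive _ _ _ _ _ _ _ (dl t a' b')).
have df a' b' (t : R^o) :
    differentiable (fun t : R^o => a' * sin t + b' * cos t : R^o) t.
  exact: (derivable1_diffP _ _).1 (dd a' b' t).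
elim: k a b => [|k IH] a b.
  by move=> t _; exact: differentiable_continuous (df a b t).
split=> [t _|u]; first exact: df.
suff e : (fun t0 : R^o => 'd (fun t : R^o => a * sin t + b * cos t : R^o) t0 u) =
    (fun t : R^o => (- b * u) * sin t + (a * u) * cos t : R^o).
  by rewrite e; exact: (IH (- b * u) (a * u)).
apply/funext => t; have H := deriv1E (dd a b t).
apply: (etrans (congr1 (fun h : R -> R => h u) H)).
rewrite derive1E (@derive_val _ _ _ _ _ _ _ (dl t a b)).
rewrite -[LHS]/(u * _) mulrDr addrC; congr (_ + _).
  by rewrite mulrN mulrN mulNr mulNr mulrA (mulrC u).
by rewrite mulrA (mulrC u).
Qed.

Lemma sm_sin (t : R^o) : sm (sin : R^o -> R^o) t /\ 'd (sin : R^o -> R^o) t 1 = cos t.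
Proof.
split.
  exists setT; split => // [|k]; first exact: openT.
  rewrite (_ : (sin : R^o -> R^o) = fun t : R^o => 1 * sin t + 0 * cos t : R^o).
    exact: Ck_sin_cos.
  by apply/funext => r; rewrite mul1r mul0r addr0.
have dd : derivable (@sin R) t 1 by exact: ex_derive.
rewrite (congr1 (fun h : R -> R => h 1) (deriv1E dd)) derive1E derive_val.
exact: scale1r.
Qed.

End Sine.

Section Curves.
Context {R : realType}.

Lemma mopenT (V : normedModType R) (T : charted V) (okT : atlas_ok T) : mopen (@setT T).
Proof. by apply/mopenP => p _; exact: filterT. Qed.

(* The curve is [s |-> param x (chart x x + e sin (s / e) u)]: the sine keeps it
   inside a given chart ball for all times. *)
Lemma curve_through (d : nat) (M : charted 'rV[R]_d) (okM : atlas_ok M) (x : M)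
    (u : 'rV[R]_d) (U : set M) : mnbhs x U ->
  exists c : model R^o -> M, [/\ forall t, smooth_at c t, c 0 = x, forall t, U (c t) &
    dmap c 0 1 = u].
Proof.
move=> xU; have xx : dom x x by exact: dom_refl.
have N1 : \forall a \near chart x x, U (param x a) by exact: xU.
have [e /= e0 eP] : exists2 e : R, 0 < e & forall a, `|chart x x - a| < e ->
    [/\ dom x (param x a), chart x (param x a) = a & U (param x a)].
  have N : \forall a \near chart x x,
      [/\ dom x (param x a), chart x (param x a) = a & U (param x a)].
    by apply: (nearS2 _ (near_chart xx xx) N1) => a [? _ ?] ?; split.
  by have /nbhs_normP[e /= e0 H] := N; exists e => // a /H.
(* The amplitude of the sine: adding 1 keeps the divisor positive for [u = 0] and makes r times the
   norm of [u] strictly smaller than [e]. The rate [r^-1] inside the sine then gives [rho] the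
   derivative 1 at 0. *)
pose r := e / (`|u| + 1).
have u1 : 0 < `|u| + 1 by rewrite ltr_wpDl.
have r0 : 0 < r by rewrite divr_gt0.
pose rho (t : R^o) : R^o := r * sin (r^-1 * t).
have srho t : sm rho t.
  apply: sm_mul; first exact: sm_cst.
  apply: (sm_comp (f := fun t : R^o => r^-1 * t : R^o) (g := (sin : R^o -> R^o))).
    by apply: sm_mul; [exact: sm_cst|exact: sm_id].
  exact: (sm_sin _).1.
pose line (t : R^o) : 'rV[R]_d := chart x x + (rho t : R) *: u.
have sline t : sm line t.
  apply: sm_add; first exact: sm_cst.
  by apply: sm_scale; [exact: srho|exact: sm_cst].
have bl t : `|chart x x - line t| < e.
  rewrite /line opprD addNKr normrN normrZ normrM (gtr0_norm r0) -mulrA.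
  apply: (@le_lt_trans _ _ (r * `|u|)).
    by rewrite ler_pM2l // ler_piMl // ler_norml sin_geN1 sin_le1.
  by rewrite /r mulrAC ltr_pdivrMr // ltr_pM2l // ltrDl.
have bl' t := eP _ (bl t).
have s2 t : smooth_at (param x : model 'rV[R]_d -> M) (line t).
  by have [dl cl _] := bl' t; rewrite -{1}cl; exact: smooth_at_param.
have s1 t : smooth_at (line : model R^o -> model 'rV[R]_d) t by exact: smooth_at_model.
have l0 : line 0 = chart x x by rewrite /line /rho mulr0 sin0 mulr0 scale0r addr0.
exists (fun t => param x (line t)); split.
- by move=> t; exact: (smooth_at_comp (s1 t) (s2 t)).
- by rewrite l0 paramK.
- by move=> t; have [] := bl' t.
apply: (etrans (dmap_comp (S := model R^o) (T := model 'rV[R]_d) (Q := M)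
  (f := line) (g := param x) (1 : R^o) (s1 0) (s2 0))).
have drho : 'd rho 0 1 = 1.
  have sl : sm (fun t : R^o => r^-1 * t : R^o) 0.
    by apply: sm_mul; [exact: sm_cst|exact: sm_id].
  have ssin : sm (fun t : R^o => sin (r^-1 * t) : R^o) 0.
    by apply: (sm_comp (f := fun t : R^o => r^-1 * t : R^o) (g := (sin : R^o -> R^o)));
      [exact: sl|exact: (sm_sin _).1].
  have did : 'd (fun t : R^o => t) 0 1 = 1 by apply: diff_linear => // y; exact: cvg_id.
  have e1 : 'd (fun t : R^o => r^-1 * t : R^o) 0 1 = r^-1.
    apply: (etrans (@diff_sm_mul R R^o (fun=> r^-1) (fun t => t) 0 1 (sm_cst _ _)
      (sm_id _))).
    apply: (etrans (congr2 (fun y y' : R => r^-1 * y + 0 * y') did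
      (diff_sm_cst (r^-1 : R^o) (0 : R^o) 1))).
    by rewrite mulr1 mul0r addr0.
  have e2 : 'd (fun t : R^o => sin (r^-1 * t) : R^o) 0 1 = r^-1.
    apply: (etrans (sm_comp_diff (f := fun t : R^o => r^-1 * t : R^o)
      (g := (sin : R^o -> R^o)) (1 : R^o) sl (sm_sin _).1)).
    apply: (etrans (congr1 _ e1)).
    have l1 (y w : R^o) : 'd (sin : R^o -> R^o) y w = w *: 'd (sin : R^o -> R^o) y 1.
      by rewrite -linearZ; congr ('d _ _ _); rewrite -[RHS]/(w * 1) mulr1.
    apply: (etrans (l1 _ _)); apply: (etrans (congr1 _ (sm_sin _).2)).
    by rewrite mulr0 cos0 -[LHS]/(r^-1 * 1) mulr1.
  apply: (etrans (@diff_sm_mul R R^o (fun=> r) (fun t : R^o => sin (r^-1 * t)) 0 1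
    (sm_cst _ _) ssin)).
  apply: (etrans (congr2 (fun y y' : R => r * y + sin (r^-1 * 0) * y') e2
    (diff_sm_cst (r : R^o) (0 : R^o) 1))).
  by rewrite mulr0 addr0 divff // gt_eqF.
have dline : 'd line 0 1 = u.
  have sZ : sm (fun t : R^o => (rho t : R) *: u) 0.
    by apply: sm_scale; [exact: srho|exact: sm_cst].
  apply: (etrans (@diff_sm_add R R^o 'rV[R]_d (fun=> chart x x) (fun t : R^o =>
    (rho t : R) *: u) 0 1 (sm_cst _ _) sZ)).
  have H := diffZl u (sm_differentiable (srho 0)).
  apply: (etrans (congr2 +%R (diff_sm_cst _ _ _) (congr1 (fun h : R^o -> 'rV[R]_d
    => h 1) H))).
  by rewrite add0r [X in X *: u]drho scale1r.
rewrite [X in dmap _ _ X]dline l0.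
have N : \forall a \near chart x x, a = chart x (param x a).
  by apply: (nearS _ (near_chart xx xx)) => a [_ _ E1]; rewrite -[LHS]E1.
rewrite /dmap /= (paramK xx).
apply: (etrans (diff_eq_near u N (sm_id _))).
by apply: diff_linear => // y; exact: cvg_id.
Qed.

Section LocalSection.
Context {d r : nat} {M : charted 'rV[R]_d} {okM : atlas_ok M} {E : bundle M r}.
Context {okE : atlas_ok E}.

(** In a local trivialisation [h], keep the fibre coordinate of [h z] and let the base point
    vary. *)
Lemma local_section (z : E) : vector_bundle E ->
  exists (U : set M) (s : M -> E), [/\ mnbhs (Defs.proj z) U, s (Defs.proj z) = z &
    forall y, U y -> smooth_at s y /\ Defs.proj (s y) = y].
Proof.
move=> [_ _ /(_ (Defs.proj z))[U [h [oU Uz [_ [g [sg hg gh]]] hproj _]]]].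
exists U, (fun y => g (y, (h z).2)); split.
- exact: ((mopenP U).1 oU).
- have [_ gz] := hg z Uz; apply: (etrans _ gz); congr g.
  by apply: injective_projections; rewrite //= hproj.
move=> y Uy; have oU' : mopen [set q : mprod M (model 'rV[R]_r) | U q.1].
  apply/mopenP => q Uq; apply: (smooth_at_cvg (f := fst : mprod M (model 'rV[R]_r) -> M)).
    exact: smooth_at_fst.
  exact: ((mopenP U).1 oU).
split.
  apply: (smooth_at_comp (f := fun y : M => (y, (h z).2) : mprod M (model 'rV[R]_r))).
    by apply: smooth_at_pair; [exact: smooth_at_id|exact: smooth_at_cst].
  exact: (smooth_on_at oU' sg).
have [Ug hgy] := gh (y, (h z).2) Uy.
by rewrite -hproj // hgy.
Qed.

End LocalSection.

End Curves.

Section ChiFormula.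
Context {R : realType} {m : nat} {M : charted 'rV[R]_(2 * m)} {okM : atlas_ok M}.
Context {E E' : bundle M m} {okE : atlas_ok E} {okE' : atlas_ok E'}.
Context {phi : form1 E} {phi' : form1 E'} {chi : mprod E E' -> cotangent M}.

(** [chi_map] speaks only of velocities of curves in [Ehat]. Every [u] is the base velocity of such
    a curve: lift a base curve by local sections through both components of [z]. The components of
    the lifted velocity both project to [u], so the forms take the values [hval]. *)
Lemma chi_formula : vector_bundle E -> vector_bundle E' ->
  smooth_form1 phi -> smooth_form1 phi' -> horizontal phi -> horizontal phi' ->
  chi_map phi phi' chi ->
  forall z, Ehat z -> forall u,
    covec (chi z) u = hval phi' (@Defs.proj _ _ _ _ E') z.2 u - hval phi
      (@Defs.proj _ _ _ _ E) z.1 u.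
Proof.
move=> vE vE' sphi sphi' hphi hphi' chiP z zE u.
have sproj (y : E) : smooth_at (@Defs.proj _ _ _ _ E) y.
  by case: vE => _ sp _; exact: (smooth_on_at (mopenT _) sp).
have sproj' (y : E') : smooth_at (@Defs.proj _ _ _ _ E') y.
  by case: vE' => _ sp _; exact: (smooth_on_at (mopenT _) sp).
have [U [s [nU sz sP]]] := local_section z.1 vE.
have [U' [s' [nU' sz' sP']]] := local_section z.2 vE'.
rewrite -[Defs.proj z.2]zE in nU' sz'.
(* [tangent] wants a curve lying in [Ehat] at all times, so the base curve must never leave the
   common domain of the two sections. *)
have [c [sc c0 cU dc]] := curve_through okM u (filterI nU nU').
pose cc (t : model R^o) : mprod E E' := (s (c t), s' (c t)).
have s1 t : smooth_at (fun t => s (c t)) t.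
  by apply: (smooth_at_comp (sc t)); exact: (sP _ (cU t).1).1.
have s2 t : smooth_at (fun t => s' (c t)) t.
  by apply: (smooth_at_comp (sc t)); exact: (sP' _ (cU t).2).1.
have scc t : smooth_at cc t by exact: smooth_at_pair.
have cc0 : cc 0 = z.
  by rewrite /cc c0; apply: injective_projections.
have tw : tangent Ehat z (dmap cc 0 1).
  exists cc; split=> //; first by apply: smooth_at_on.
  by move=> t; rewrite /Ehat /= (sP _ (cU t).1).2 (sP' _ (cU t).2).2.
have [_ /(_ _ tw)] := chiP z zE.
have e1 : dmap (@fst E E' : mprod E E' -> E) z (dmap cc 0 1) =
    dmap (fun t : model R^o => s (c t)) 0 1.
  rewrite -cc0; apply: esym; apply: (dmap_comp (f := cc)) => //.
  exact: smooth_at_fst.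
have e2 : dmap (@snd E E' : mprod E E' -> E') z (dmap cc 0 1) =
    dmap (fun t : model R^o => s' (c t)) 0 1.
  rewrite -cc0; apply: esym; apply: (dmap_comp (f := cc)) => //.
  exact: smooth_at_snd.
have p1 : dmap (@Defs.proj _ _ _ _ E) z.1 (dmap (fun t : model R^o => s (c t)) 0 1) = u.
  have <- : s (c 0) = z.1 by rewrite c0.
  pose proof (dmap_comp (Q := M) (f := fun t : model R^o => s (c t)) (g := Defs.proj)
    (1 : R^o) (s1 0) (sproj _)) as H.
  apply: (etrans (esym H)).
  have -> : (fun t : model R^o => Defs.proj (s (c t))) = c.
    by apply/funext => t; exact: (sP _ (cU t).1).2.
  exact: dc.
have p2 : dmap (@Defs.proj _ _ _ _ E') z.2 (dmap (fun t : model R^o => s' (c t)) 0 1) = u.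
  have <- : s' (c 0) = z.2 by rewrite c0.
  pose proof (dmap_comp (Q := M) (f := fun t : model R^o => s' (c t)) (g := Defs.proj)
    (1 : R^o) (s2 0) (sproj' _)) as H.
  apply: (etrans (esym H)).
  have -> : (fun t : model R^o => Defs.proj (s' (c t))) = c.
    by apply/funext => t; exact: (sP' _ (cU t).2).2.
  exact: dc.
have p0 : dmap (fun y : mprod E E' => Defs.proj y.1) z (dmap cc 0 1) = u.
  rewrite -p1 -e1; apply: (dmap_comp (f := fst : mprod E E' -> E)).
    exact: smooth_at_fst.
  exact: sproj.
rewrite p0 => ->; rewrite /pull1 e1 e2.
by rewrite (hvalE _ _ sphi.1 hphi) (hvalE _ _ sphi'.1 hphi') p1 p2.
Qed.

End ChiFormula.

(** * Cycles near the diagonal *)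

Section Cyclic.
Context {R : realType}.

(** This keeps the entries 1 and -1 of a row apart; for [n = 1] they would fall on the same place
    and the row sum would be 1. *)
Lemma ordS_neq n (i : 'I_n) : (2 <= n)%N -> ordS i != i.
Proof.
move=> n2; rewrite -val_eqE /=; have [lt|ge] := ltnP i.+1 n.
  by rewrite modn_small // gtn_eqF.
have -> : i.+1 = n by apply/eqP; rewrite eqn_leq ge andbT.
by rewrite modnn; apply: contraTneq ge => <-; rewrite -ltnNge.
Qed.

Lemma sum_cyclic_row n (k : 'I_n) (F : 'I_n -> R) : (2 <= n)%N ->
  \sum_j cyclic_matrix R n k j * F j = F (ordS k) - F k.
Proof.
move=> n2; have kS := ordS_neq k n2.
rewrite (bigD1 (ordS k)) //= (bigD1 k) ?[k == _]eq_sym //= big1 => [|j /andP[jS jk]].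
  by rewrite !mxE !eqxx eq_sym (negbTE kS) mul1r mulN1r addr0.
by rewrite mxE (negbTE jS) eq_sym (negbTE jk) mul0r.
Qed.

Lemma sum_cyclic_col n (k : 'I_n) (F : 'I_n -> R) : (2 <= n)%N ->
  \sum_i cyclic_matrix R n i k * F i = F (ord_pred k) - F k.
Proof.
move=> n2; have kS := ordS_neq (ord_pred k) n2.
rewrite ord_predK in kS.
rewrite (bigD1 (ord_pred k)) //= (bigD1 k) //= big1 => [|i /andP[iS ik]].
  rewrite !mxE ord_predK !eqxx eq_sym (negbTE (ordS_neq k n2)).
  by rewrite mul1r mulN1r addr0.
rewrite mxE (negbTE ik); case: eqP => [ki|]; last by rewrite mul0r.
by rewrite ki ordSK eqxx in iS.
Qed.

End Cyclic.

Lemma mnbhs_ith (R : realType) (d n : nat) (M : charted 'rV[R]_d) (okM : atlas_ok M)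
    (x : mpow n M) (Q : 'I_n -> set M) : (forall i, mnbhs (x i) (Q i)) ->
  mnbhs x [set y | forall i, Q i (y i)].
Proof.
move=> nQ; apply: (@filter_forall _ _ (fun i (y : mpow n M) => Q i (y i)) (mnbhs x)).
by move=> i; exact: (smooth_at_cvg (smooth_at_ith i x) (nQ i)).
Qed.

Lemma covec_inj (R : realType) (d : nat) (M : charted 'rV[R]_d) (a b : cotangent M) :
  (forall u, covec a u = covec b u) -> a.2 = b.2.
Proof.
move=> ab; apply/rowP => i; have := ab (delta_mx 0 i).
by rewrite /covec -!rowE !mxE.
Qed.

(** * Chart balls on which segments stay in the domain of [C] *)

Section Balls.
Context {R : realType} {d n : nat} {M : charted 'rV[R]_d} {okM : atlas_ok M}.
Context (W0 : set (mprod (mpow n M) (mpow n M))).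

(** The last clause quantifies over two independent tuples of the ball, so that one copy can move
    along a segment while the other rests, in either order, without leaving [W0]. *)
Definition admissible (x0 : M) (e : R) : Prop :=
  [/\ 0 < e,
      forall a, ball (chart x0 x0) e a -> dom x0 (param x0 a) /\ chart x0 (param x0
        a) = a &
      forall A A' : 'I_n -> 'rV[R]_d, (forall i, ball (chart x0 x0) e (A i)) ->
        (forall i, ball (chart x0 x0) e (A' i)) ->
        W0 (fun i => param x0 (A i), fun i => param x0 (A' i))].

Definition chart_ball (x0 : M) (e : R) (p : M) : Prop :=
  dom x0 p /\ ball (chart x0 x0) e (chart x0 p).

Lemma chart_ball_open x0 e p : chart_ball x0 e p -> mnbhs p (chart_ball x0 e).
Proof.
move=> [dp bp]; apply/(mnbhsE _ dp).
have N : \forall a \near chart x0 p, ball (chart x0 x0) e a.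
  have e0 : 0 < e by exact: bp.1.
  by apply: open_nbhs_nbhs; split; [exact: ball_open|exact: bp].
by apply: (nearS2 _ N (near_chart dp dp)) => a ba [da _ ca]; split; rewrite ?ca.
Qed.

Lemma exists_admissible x0 : mopen W0 -> W0 (fun=> x0, fun=> x0) ->
  exists e, admissible x0 e.
Proof.
move=> oW0 Wx; pose p : mprod (mpow n M) (mpow n M) := (fun=> x0, fun=> x0).
have N : \forall A \near chart p p, W0 (param p A) by exact: ((mopenP W0).1 oW0 p Wx).
have [e1 /= e10 H1] := (nbhs_ballP _ _).1 N.
have xx : dom x0 x0 by exact: dom_refl.
have N2 : \forall a \near chart x0 x0, dom x0 (param x0 a) /\ chart x0 (param x0 a) = a.
  by apply: (nearS _ (near_chart xx xx)) => a [].
have [e2 /= e20 H2] := (nbhs_ballP _ _).1 N2.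
exists (Num.min e1 e2); split.
- by rewrite lt_min e10 e20.
- by move=> a ba; apply: H2; apply: le_ball ba; rewrite ge_min lexx orbT.
move=> A A' bA bA'.
have e1e : Num.min e1 e2 <= e1 by rewrite ge_min lexx.
have eB (B : 'I_n -> 'rV[R]_d) :
    (fun i => param x0 (row i (\matrix_i B i))) = (fun i => param x0 (B i)).
  by apply/funext => i; rewrite rowK.
rewrite -(eB A) -(eB A').
(* Balls of pairs and of matrices are entrywise, so it suffices to bound each row. *)
apply: (H1 (\matrix_i A i, \matrix_i A' i)); split; split=> // i j; rewrite !mxE.
  exact: le_ball e1e _ ((bA i).2 0 j).
exact: le_ball e1e _ ((bA' i).2 0 j).
Qed.

(* The path is the straight chart segment from [x] to the centre of the ball. *)
Lemma segment_path (x : mpow n M) x0 e : admissible x0 e ->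
  (forall i, chart_ball x0 e (x i)) ->
  exists path : model R^o -> mpow n M, [/\ path 0 = x,
    forall i j, path 1 i = path 1 j & forall t : R, 0 <= t <= 1 ->
    [/\ smooth_at path t, W0 (x, path t) & W0 (path t, x)]].
Proof.
move=> [e0 H1 H2] bx.
pose A (i : 'I_n) (t : R^o) : 'rV[R]_d :=
  chart x0 (x i) + (t : R) *: (chart x0 x0 - chart x0 (x i)).
have Ax : x = fun i => param x0 (chart x0 (x i)).
  by apply/funext => i; rewrite paramK //; exact: (bx i).1.
have bA i (t : R) : 0 <= t <= 1 -> ball (chart x0 x0) e (A i t).
  move=> /andP[t0 t1]; have [_ +] := bx i; rewrite -ball_normE /ball_ /= => b.
  have -> : chart x0 x0 - A i t = (1 - t) *: (chart x0 x0 - chart x0 (x i)).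
    by rewrite /A opprD addrA scalerBl scale1r.
  rewrite normrZ (le_lt_trans _ b) // ler_piMl // ger0_norm ?subr_ge0 //.
  by rewrite lerBlDr lerDl.
exists (fun t i => param x0 (A i t)); split.
- by rewrite [RHS]Ax; apply/funext => i; rewrite /A scale0r addr0.
- by move=> i j; rewrite /A !scale1r !subrKC.
move=> t t01; split.
- apply: smooth_at_comp_pow => i.
  have [dA cA] := H1 _ (bA i t t01).
  apply: (smooth_at_comp (f := A i : model R^o -> model 'rV[R]_d) (g := param x0)).
    exact/smooth_at_model/(diff_affine _ _ _ 0).1.
  by rewrite -cA; exact: smooth_at_param.
- rewrite {1}Ax; apply: H2; first by move=> i; exact: (bx i).2.
  by move=> i; exact: bA.
- rewrite {1}Ax; apply: H2; first by move=> i; exact: bA.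
  by move=> i; exact: (bx i).2.
Qed.

End Balls.

Theorem theorem6p1 (R : realType) (m n : nat)
  (M : charted 'rV[R]_(2 * m)) (omega : form2 M)
  (E E' : bundle M m) (lam : E -> M) (lam' : E' -> M)
  (phi : form1 E) (phi' : form1 E')
  (chi : mprod E E' -> cotangent M) (W1 W2 : set (mprod E E'))
  (f : cotangent M -> mprod M M)
  (WGamma : set (mprod E E')) (VGamma : set (mprod M M))
  (gamma : mprod M M -> M)
  (W0 : set (mprod (mpow n M) (mpow n M)))
  (C : mprod (mpow n M) (mpow n M) -> R) :
  (2 <= n)%N ->
  is_manifold M -> symplectic omega ->
  lagrangian_field omega lam -> lagrangian_field omega lam' ->
  transversal_fields lam lam' ->
  field_form omega lam phi -> field_form omega lam' phi' ->
  chi_map phi phi' chi ->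
  open_nbhd_in Ehat Zhat W1 ->
  diffeo W1 (chi @` W1) chi -> open_nbhd_of zero_section (chi @` W1) ->
  open_nbhd_in Ehat Zhat W2 ->
  diffeo W2 (lam_pair lam lam' @` W2) (lam_pair lam lam') ->
  open_nbhd_of diagonal2 (lam_pair lam lam' @` W2) ->
  (forall z, (W1 `&` W2) z -> f (chi z) = lam_pair lam lam' z) ->
  open_nbhd_in (Gamma lam lam') Zhat WGamma ->
  open_nbhd_of diagonal2 VGamma ->
  diffeo WGamma VGamma proj_pair ->
  (forall z, WGamma z -> gamma (proj_pair z) = lam z.1) ->
  calabi VGamma (pull2 gamma omega) (cyclic_matrix R n) W0 C ->
  let Cn := fun x : mpow n M => C (x, x) in
  exists (N : set (mpow n M)) (O : set (mpow n (cotangent M))),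
    [/\ open_nbhd_of [set x : mpow n M | exists y, x = fun=> y] N,
        N `<=` [set x | W0 (x, x)],
        open_nbhd_of [set a : mpow n (cotangent M) | exists y, a = fun=> (y, 0)] O
      & cycles (chi @` (W1 `&` W2)) f `&` O =
        [set a : mpow n (cotangent M) | exists2 x : mpow n M, N x &
           forall k, (a k).1 = x k /\
             forall u, covec (a k) u =
               dfun (fun y : M => Cn [eta x with k |-> y]) (x k) u] `&` O].
Proof.
move=> n2 manM [somega _ _] lfE lfE' _ [sphi hphi phi0 dphi] [sphi' hphi' phi0' dphi'].
move=> chiP [[D1 oD1 W1E] ZW1] [schi [g [sg gchi chig]]] [oV ZV].
move=> [[D2 oD2 W2E] ZW2] _ _ fP [[DG oDG WGE] ZWG] [oVG dVG].
move=> [_ [r [sr rP prP]]] gammaP calC Cn.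
have okM : atlas_ok M by exact: is_manifold_ok.
have [vE [slam _ _] _ lamz] := lfE; have [vE' [slam' _ _] _ lamz'] := lfE'.
have okE : atlas_ok E by case: vE => /is_manifold_ok.
have okE' : atlas_ok E' by case: vE' => /is_manifold_ok.
pose pi := @Defs.proj R (2 * m) M m E; pose pi' := @Defs.proj R (2 * m) M m E'.
have spi z : smooth_at pi z by case: vE => _ sp _; exact: (smooth_on_at (mopenT _) sp).
have spi' z : smooth_at pi' z by case: vE' => _ sp _; exact: (smooth_on_at (mopenT _) sp).
have sl z : smooth_at lam z by exact: (smooth_on_at (mopenT _) slam).
have sl' z : smooth_at lam' z by exact: (smooth_on_at (mopenT _) slam').
pose r1 (p : mprod M M) : E := (r p).1; pose r2 (p : mprod M M) : E' := (r p).2.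
have srp p : VGamma p -> smooth_at r p by exact: (smooth_on_at oVG sr).
have sr1 p : VGamma p -> smooth_at r1 p.
  by move=> /srp sp; apply: (smooth_at_comp sp); exact: smooth_at_fst.
have sr2 p : VGamma p -> smooth_at r2 p.
  by move=> /srp sp; apply: (smooth_at_comp sp); exact: smooth_at_snd.
have pr1 p : VGamma p -> pi (r1 p) = p.1 by move=> /prP[_ {2}<-].
have pr2 p : VGamma p -> pi' (r2 p) = p.2 by move=> /prP[_ {2}<-].
have gr1 p : VGamma p -> gamma p = lam (r1 p).
  by move=> /prP[wg {1}<-]; exact: gammaP.
have rG p : VGamma p -> lam (r1 p) = lam' (r2 p).
  by move=> /prP[]; rewrite WGE => -[].
have gr2 p : VGamma p -> gamma p = lam' (r2 p) by move=> vp; rewrite gr1 // rG.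
pose zh y : mprod E E' := (zsec E y, zsec E' y).
have Zzh y : Zhat (zh y) by exists y.
(* The pair of zero vectors lies in [WGamma] over [(y, y)], and [r] inverts the projection there. *)
have rzh y : r (y, y) = zh y by have [_ /=] := rP _ (ZWG _ (Zzh y)).
have hz y u : hval phi pi (zsec E y) u = 0 by exact: phi0.
have hz' y u : hval phi' pi' (zsec E' y) u = 0 by exact: phi0'.
pose proof (chi_formula vE vE' sphi sphi' hphi hphi' chiP) as chiF.
have Ezh y : Ehat (zh y) by [].
have chizh y : chi (zh y) = (y, 0).
  have [c1 _] := chiP _ (Ezh y).
  apply: injective_projections; first exact: c1.
  apply: (covec_inj (a := chi (zh y)) (b := (y, 0))) => u.
  by rewrite chiF // hz hz' subr0 /covec trmx0 mulmx0 mxE.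
have W0diag x : VGamma (x, x) -> W0 (fun=> x, fun=> x).
  by move=> vx; case: calC => -[_ dW0] _ _ _ _; apply: dW0; exists (x, x).
have oW0 : mopen W0 by case: calC => -[].
have VGd x : VGamma (x, x) by exact: dVG.
(* A common chart ball supplies the path from [x] to the diagonal. Each cyclic sum has two terms,
   and the one at the pair [(x k, x k)] vanishes by [hz] or [hz']. *)
have dCn (x : mpow n M) x0 e : admissible W0 x0 e -> (forall i, chart_ball x0 e (x i)) ->
  forall k u, dfun (fun y : M => Cn [eta x with k |-> y]) (x k) u =
    hval phi' pi' (r2 (x (ord_pred k), x k)) u - hval phi pi (r1 (x k, x (ordS k))) u.
  move=> ae bx k u; have [path [p0 p1 pP]] := segment_path ae bx.
  have rowc i : \sum_j cyclic_matrix R n i j = 0.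
    rewrite -[RHS](subrr (1 : R)) -(sum_cyclic_row i (fun=> 1 : R) n2).
    by apply: eq_bigr => j _; rewrite mulr1.
  have colc j : \sum_i cyclic_matrix R n i j = 0.
    rewrite -[RHS](subrr (1 : R)) -(sum_cyclic_col j (fun=> 1 : R) n2).
    by apply: eq_bigr => i _; rewrite mulr1.
  pose proof (dfun_diagonal somega sphi sphi' hphi hphi' dphi dphi' sl spi sl' spi'
    oVG sr1 sr2 pr1 pr2 gr1 gr2 calC k u p0 p1 pP rowc colc) as H.
  apply: (etrans H).
  rewrite (sum_cyclic_col k (fun i => hval phi' pi' (r2 (x i, x k)) u) n2).
  rewrite (sum_cyclic_row k (fun j => hval phi pi (r1 (x k, x j)) u) n2).
  by rewrite /r1 /r2 rzh /= hz hz' !subr0.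
(* Both components lie over [x k], so this is a point of [Ehat]; by [dCn] and [chi_formula], [chi]
   takes there the differential of [Cn] in its argument [k]. *)
pose side (x : mpow n M) k : mprod E E' :=
  (r1 (x k, x (ordS k)), r2 (x (ord_pred k), x k)).
(* The three clauses make [r] defined at consecutive points, place [side] in [W1] and [W2]
   (membership in the ambient open sets [D1], [D2] suffices inside [Ehat]), and make [dCn]
   applicable. *)
pose N : set (mpow n M) := [set x | [/\ forall k, VGamma (x k, x (ordS k)),
  forall k, D1 (side x k) /\ D2 (side x k) &
  exists x0 e, admissible W0 x0 e /\ forall i, chart_ball x0 e (x i)]].
have VGpred (x : mpow n M) k : (forall k, VGamma (x k, x (ordS k))) ->
    VGamma (x (ord_pred k), x k).
  by move=> /(_ (ord_pred k)); rewrite ord_predK.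
have smooth_two (i j : 'I_n) (x : mpow n M) :
    smooth_at (fun y : mpow n M => (y i, y j) : mprod M M) x.
  by apply: smooth_at_pair; exact: smooth_at_ith.
have smooth_side (x : mpow n M) k : (forall k, VGamma (x k, x (ordS k))) ->
    smooth_at (fun y : mpow n M => side y k) x.
  move=> vx; apply: smooth_at_pair.
    by apply: (smooth_at_comp (smooth_two k (ordS k) x)); exact/sr1.
  by apply: (smooth_at_comp (smooth_two (ord_pred k) k x)); exact/sr2/VGpred.
have open_near (V : normedModType R) (T : charted V) (okT : atlas_ok T) (D : set T) p :
    mopen D -> D p -> mnbhs p D by move=> /mopenP; exact.
have oN : mopen N.
  apply/mopenP => x [vx sx [x0 [e [ae bx]]]].
  have n1 : mnbhs x [set y | forall k, VGamma (y k, y (ordS k))].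
    apply: (@filter_forall _ _ (fun k (y : mpow n M) => VGamma (y k, y (ordS k)))
      (mnbhs x)) => k.
    exact: (smooth_at_cvg (smooth_two k (ordS k) x) (open_near _ _ _ _ _ oVG (vx k))).
  have n2' : mnbhs x [set y | forall k, D1 (side y k) /\ D2 (side y k)].
    apply: (@filter_forall _ _ (fun k (y : mpow n M) => D1 (side y k) /\ D2 (side y
      k)) (mnbhs x)) => k.
    have [d1 d2] := sx k.
    pose proof (smooth_at_cvg (smooth_side x k vx) (open_near _ _ _ _ _ oD1 d1)) as m1.
    pose proof (smooth_at_cvg (smooth_side x k vx) (open_near _ _ _ _ _ oD2 d2)) as m2.
    exact: filterI m1 m2.
  have n3 : mnbhs x [set y | forall i, chart_ball x0 e (y i)].
    apply: (mnbhs_ith okM (x := x) (Q := fun=> chart_ball x0 e)) => i.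
    exact: chart_ball_open.
  have nF : Filter (mnbhs x) by exact: mnbhs_filter.
  have n4 := @filterI _ _ nF _ _ (@filterI _ _ nF _ _ n1 n2') n3.
  apply: (@filterS _ (mnbhs x) nF _ _ _ n4) => y [[h1 h2] h3].
  by split=> //; exists x0, e.
have sidediag y k : side (fun=> y) k = zh y by rewrite /side /r1 /r2 rzh.
have D1zh y : D1 (zh y) by have := ZW1 _ (Zzh y); rewrite W1E => -[].
have D2zh y : D2 (zh y) by have := ZW2 _ (Zzh y); rewrite W2E => -[].
have dN y : N (fun=> y).
  split=> //; first by move=> k; rewrite sidediag.
  have [e ae] := exists_admissible oW0 (W0diag y (VGd y)).
  exists y, e; split=> // i; split; first exact: dom_refl.
  by apply: ballxx; case: ae.
have NW x : N x -> W0 (x, x).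
  move=> [_ _ [x0 [e [ae bx]]]]; have [path [p0 _ pP]] := segment_path ae bx.
  by have [|_ +] := pP 0; rewrite ?lexx ?ler01 // p0.
pose base (a : mpow n (cotangent M)) : mpow n M := fun k => (a k).1.
(* On the image of [W1] the map [g] inverts [chi]. The cycle condition only yields points of
   [Gamma]; [DG] places them in [WGamma], where [r] inverts the projection. *)
pose Q : set (mpow n (cotangent M)) := [set a | [/\ forall k, (chi @` W1) (a k),
  forall k, D2 (g (a k)), forall k, DG ((g (a k)).1, (g (a (ordS k))).2) & N (base a)]].
exists N, Q; split.
- by split=> // x [y ->].
- by move=> x /NW.
- split; last first.
    move=> a [y ->]; have gz : g (y, 0) = zh y.
      by rewrite -chizh; have [] := gchi _ (ZW1 _ (Zzh y)).
    split; [by move=> k; exact: ZV|by move=> k; rewrite gz| |exact: dN y].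
    by move=> k; rewrite gz; have := ZWG _ (Zzh y); rewrite WGE => -[].
  apply/mopenP => a [a1 a2 a3 a4].
  have nF : Filter (mnbhs a) by exact: mnbhs_filter.
  have sith i : smooth_at (fun b : mpow n (cotangent M) => b i) a by exact: smooth_at_ith.
  have sgi i : smooth_at (fun b : mpow n (cotangent M) => g (b i)) a.
    by apply: (smooth_at_comp (sith i)); exact: (smooth_on_at oV sg).
  have sbase : smooth_at base a.
    by apply: smooth_at_comp_pow => i; apply: (smooth_at_comp (sith i)); exact:
      smooth_at_base.
  have spair i j : smooth_at (fun b : mpow n (cotangent M) =>
      ((g (b i)).1, (g (b j)).2) : mprod E E') a.
    apply: smooth_at_pair.
      by apply: (smooth_at_comp (sgi i)); exact: smooth_at_fst.
    by apply: (smooth_at_comp (sgi j)); exact: smooth_at_snd.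
  have n1 : mnbhs a [set b | forall k, (chi @` W1) (b k)].
    apply: (@filter_forall _ _ (fun k (b : mpow n (cotangent M)) => (chi @` W1) (b
      k)) (mnbhs a) nF) => k.
    exact: (smooth_at_cvg (sith k) (open_near _ _ _ _ _ oV (a1 k))).
  have n2' : mnbhs a [set b | forall k, D2 (g (b k))].
    apply: (@filter_forall _ _ (fun k (b : mpow n (cotangent M)) => D2 (g (b k)))
      (mnbhs a) nF) => k.
    exact: (smooth_at_cvg (sgi k) (open_near _ _ _ _ _ oD2 (a2 k))).
  have n3 : mnbhs a [set b | forall k, DG ((g (b k)).1, (g (b (ordS k))).2)].
    apply: (@filter_forall _ _ (fun k (b : mpow n (cotangent M)) => DG ((g (b
      k)).1, (g (b (ordS k))).2)) (mnbhs a) nF) => k.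
    exact: (smooth_at_cvg (spair k (ordS k)) (open_near _ _ _ _ _ oDG (a3 k))).
  have n4 : mnbhs a [set b | N (base b)].
    exact: (smooth_at_cvg sbase (open_near _ _ _ _ _ oN a4)).
  have n5 := @filterI _ _ nF _ _ (@filterI _ _ nF _ _ n1 n2') (@filterI _ _ nF _ _ n3 n4).
  apply: (@filterS _ (mnbhs a) nF _ _ _ n5) => b [[h1 h2] [h3 h4]].
  by split.
apply/seteqP; split=> a.
- move=> [cyc Qa]; split=> //; have [a1 a2 a3 a4] := Qa.
  exists (base a) => // k; split=> // u.
  (* A cycle provides some preimage of [a i] in both [W1] and [W2]; since [g] inverts [chi] on [W1],
     that preimage is [g (a i)]. *)
  have zP i : [/\ W1 (g (a i)), chi (g (a i)) = a i, W2 (g (a i)) & Ehat (g (a i))].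
    have [w1 cw] := chig _ (a1 i); split=> //.
      have [[w [u1 u2] cw'] _] := cyc i.
      by have [_] := gchi _ u1; rewrite cw' => ->.
    by move: w1; rewrite W1E => -[].
  have baseE i : Defs.proj (g (a i)).1 = base a i /\ Defs.proj (g (a i)).2 = base a i.
    have [_ ci _ Ei] := zP i; have [c1 _] := chiP _ Ei.
    by rewrite -[Defs.proj (g (a i)).2]Ei -c1 ci.
  (* Through [f], composability of [a i] and [a (ordS i)] says that the first component of one and
     the second component of the next have the same image under [lam] and [lam']. Such a pair of
     [WGamma] is recovered by [r] from its base points. *)
  have rE i : r (base a i, base a (ordS i)) = ((g (a i)).1, (g (a (ordS i))).2).
    have wg : WGamma ((g (a i)).1, (g (a (ordS i))).2).
      rewrite WGE; split; first exact: a3.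
      have [_ ci w2 _] := zP i; have [w1 ci' w2' _] := zP (ordS i).
      have [w1i _ _ _] := zP i.
      have [_ +] := cyc i; rewrite -{1}ci -{1}ci' fP // fP //.
    have [_ <-] := rP _ wg; congr r.
    by rewrite /proj_pair /= (baseE i).1 (baseE (ordS i)).2.
  have [_ ck _ Ek] := zP k.
  rewrite -{1}ck (chiF _ Ek).
  have [_ _ [x0 [e [ae bx]]]] := a4.
  rewrite [RHS](dCn _ x0 e ae bx) /r1 /r2 rE.
  (* The second component at [k] comes from the pair of points that ends at [x k], hence the
     identity at the predecessor. *)
  have := rE (ord_pred k); rewrite ord_predK => ->.
  by [].
- move=> [[x Nx xa] Qa]; split=> // k.
  have [vx sx [x0 [e [ae bx]]]] := Nx.
  have Es i : Ehat (side x i).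
    rewrite /Ehat /=; have := pr1 _ (vx i); rewrite /pi => ->.
    by have := pr2 _ (VGpred x i vx); rewrite /pi' => ->.
  (* The base points agree since [side x i] lies over [x i]; the covectors agree since [chi_formula]
     and [dCn] give the same difference of horizontal values. *)
  have chiS i : chi (side x i) = a i.
    have [ai1 ai2] := xa i; apply: injective_projections.
      rewrite ai1; have [-> _] := chiP _ (Es i).
      by have := pr1 _ (vx i).
    apply: covec_inj => u; rewrite ai2 [RHS](dCn _ x0 e ae bx).
    exact: chiF.
  have WS i : (W1 `&` W2) (side x i).
    by have [d1 d2] := sx i; rewrite W1E W2E.
  split; first by exists (side x k).
  rewrite -!chiS !fP // /lam_pair /=.
  (* The source of [a k] and the target of [a (ordS k)] are the images under [lam] and [lam'] of the
     two components of [r] at the same pair of consecutive points. *)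
  by rewrite rG // ordSK.
Qed.
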